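(* Let $\mathfrak{r}$ be a connected, soluble Lie ring of finite Morley rank. Suppose that the additive group $(\mathfrak{r};+)$ has prime exponent $p > \operatorname{RM}(\mathfrak{r})$, where $\operatorname{RM}$ denotes Morley rank. Then: (i) there is a largest definable, connected, nilpotent ideal $F^\circ(\mathfrak{r}) \trianglelefteq \mathfrak{r}$; (ii) $\mathfrak{r}' = [\mathfrak{r},\mathfrak{r}]$ is nilpotent, i.e. $\mathfrak{r}' \subseteq F^\circ(\mathfrak{r})$; (iii) if $\mathfrak{u} \subseteq \mathfrak{r}$ is a definable, connected Lie subring consisting of $\mathfrak{r}$-nilpotent elements (i.e. for every $a \in \mathfrak{u}$ there is $n \in \mathbb{N}$ such that $\operatorname{ad}_a^n(\mathfrak{r}) = 0$), then $\mathfrak{u} \subseteq F^\circ(\mathfrak{r})$.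
   Context: A Lie ring is an abelian group $(\mathfrak{r};+)$ with a biadditive bracket $[\cdot,\cdot]$ satisfying $[x,x]=0$ and the Jacobi identity. A Lie ring of finite Morley rank is a Lie ring definable in a structure of finite Morley rank; definability refers to this ambient structure. A definable group is connected if it has no proper definable subgroup of finite index; a Lie ring (subring, ideal) is connected if its additive group is. A subring is an additive subgroup closed under the bracket; an ideal is an additive subgroup $I$ with $[\mathfrak{r},I]\subseteq I$. $\mathfrak{r}'=[\mathfrak{r},\mathfrak{r}]$ is the additive subgroup generated by all brackets $[x,y]$ with $x,y\in\mathfrak{r}$. Soluble means that the derived series reaches $0$ after finitely many steps; nilpotent means that the lower central series reaches $0$ after finitely many steps. $\operatorname{ad}_a(x)=[a,x]$. ''Largest'' means containing every other definable, connected, nilpotent ideal of $\mathfrak{r}$. *)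

(* Defs.v *)
From HB Require Import structures.
From mathcomp Require Import all_boot all_algebra.
From mathcomp Require Import boolp classical_sets.

Set Implicit Arguments.
Unset Strict Implicit.
Unset Printing Implicit Defensive.

Import GRing.Theory.
Local Open Scope classical_set_scope.
Local Open Scope ring_scope.

(** ** First-order structures *)

Record language := Language {
  fsymb : Type;
  fsymb_arity : fsymb -> nat;
  rsymb : Type;
  rsymb_arity : rsymb -> nat }.

(* [term L n] and [formula L n] have their free variables among [n] variables,
   indexed by ['I_n]. *)
Inductive term (L : language) (n : nat) : Type :=
| TVar (i : 'I_n)
| TApp (f : fsymb L) (args : 'I_(fsymb_arity f) -> term L n).

Inductive formula (L : language) : nat -> Type :=
| FEq n (t u : term L n) : formula L n
| FRel n (R : rsymb L) (args : 'I_(rsymb_arity R) -> term L n) : formula L n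
| FFalse n : formula L n
| FImp n (phi psi : formula L n) : formula L n
| FAll n (phi : formula L n.+1) : formula L n.

Record structure (L : language) := Structure {
  carrier :> Type;
  finterp : forall f : fsymb L, ('I_(fsymb_arity f) -> carrier) -> carrier;
  rinterp : forall R : rsymb L, ('I_(rsymb_arity R) -> carrier) -> Prop }.

Definition fcons T n (x : T) (e : 'I_n -> T) : 'I_n.+1 -> T :=
  fun i => if unlift ord0 i is Some j then e j else x.

Definition fcat T k m (x : 'I_k -> T) (b : 'I_m -> T) : 'I_(k + m) -> T :=
  fun i => match split i with inl j => x j | inr j => b j end.

Fixpoint teval L (M : structure L) n (e : 'I_n -> M) (t : term L n) : M :=
  match t with
  | TVar i => e i
  | TApp f args => finterp (fun j => teval e (args j))
  end.

Fixpoint sat L (M : structure L) n (phi : formula L n) : ('I_n -> M) -> Prop :=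
  match phi in formula _ n return ('I_n -> M) -> Prop with
  | FEq _ t u => fun e => teval e t = teval e u
  | FRel _ R args => fun e => rinterp (fun j => teval e (args j))
  | FFalse _ => fun _ => False
  | FImp _ phi psi => fun e => sat phi e -> sat psi e
  | FAll _ phi => fun e => forall x : M, sat phi (fcons x e)
  end.

(* The subset of [M^k] defined by [phi] with parameters [b]. *)
Definition solutions L (M : structure L) k m
    (phi : formula L (k + m)) (b : 'I_m -> M) : set ('I_k -> M) :=
  [set x | sat phi (fcat x b)].

Definition definable L (M : structure L) k (X : set ('I_k -> M)) : Prop :=
  exists m (phi : formula L (k + m)) (b : 'I_m -> M), X = solutions phi b.

Definition elementary_embedding L (M N : structure L) (h : M -> N) : Prop :=
  forall n (phi : formula L n) (e : 'I_n -> M), sat phi e <-> sat phi (h \o e).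

(* Every finitely satisfiable set of formulas in finitely many variables over
   finitely many parameters is realised. *)
Definition aleph0_saturated L (N : structure L) : Prop :=
  forall k m (b : 'I_m -> N) (Gamma : set (formula L (k + m))),
    (forall q (phi : 'I_q -> formula L (k + m)), (forall i, Gamma (phi i)) ->
       exists x : 'I_k -> N, forall i, sat (phi i) (fcat x b)) ->
    exists x : 'I_k -> N, forall phi, Gamma phi -> sat phi (fcat x b).

(** ** Morley rank *)

(* The inductive clauses of Morley rank, evaluated inside [N] itself; this is
   the Morley rank only when [N] is aleph0-saturated.  Finite values suffice
   here, so there is no limit clause. *)
Fixpoint rank_ge L (N : structure L) k (d : nat) (X : set ('I_k -> N)) : Prop :=
  match d with
  | 0%N => X !=set0
  | d'.+1 => exists Y : nat -> set ('I_k -> N),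
      [/\ forall i, definable (Y i), forall i, Y i `<=` X,
          trivIset setT Y & forall i, rank_ge d' (Y i)]
  end.

(* [RM(X) = d] for a definable subset [X] of [M^k]: the rank is computed on the
   same formula in an aleph0-saturated elementary extension of [M]; as usual it
   depends neither on the extension nor on the formula defining [X]. *)
Definition morley_rank L (M : structure L) k (X : set ('I_k -> M)) (d : nat) :
    Prop :=
  exists m (phi : formula L (k + m)) (b : 'I_m -> M), X = solutions phi b /\
  exists (N : structure L) (h : M -> N),
    [/\ elementary_embedding h, aleph0_saturated N,
        rank_ge d (solutions phi (h \o b)) &
        ~ rank_ge d.+1 (solutions phi (h \o b))].

Definition finite_morley_rank L (M : structure L) : Prop :=
  exists d, morley_rank (setT : set ('I_1 -> M)) d.

(** ** Lie rings *)

HB.mixin Record isLieRing V of GRing.Zmodule V := {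
  lie : V -> V -> V;
  lieDl : forall x y z, lie (x + y) z = lie x z + lie y z;
  lieDr : forall x y z, lie x (y + z) = lie x y + lie x z;
  liexx : forall x, lie x x = 0;
  lie_jacobi : forall x y z,
    lie x (lie y z) + lie y (lie z x) + lie z (lie x y) = 0 }.

#[short(type="lieRingType")]
HB.structure Definition LieRing := { V of isLieRing V & GRing.Zmodule V }.

Definition has_exponent (V : zmodType) (p : nat) : Prop :=
  [/\ (0 < p)%N, forall x : V, x *+ p = 0 &
      forall m, (0 < m)%N -> (forall x : V, x *+ m = 0) -> (p <= m)%N].

Definition additive_subgroup (V : zmodType) (A : set V) : Prop :=
  A 0 /\ forall x y, A x -> A y -> A (x - y).

Definition finite_index (V : zmodType) (A B : set V) : Prop :=
  exists s : seq V, forall x, B x -> exists2 y, y \in s & A (x - y).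

Section LieRingTheory.
Variable r : lieRingType.
Implicit Types A B I : set r.

Definition lie_span A B : set r :=
  smallest (@additive_subgroup r) [set lie x y | x in A & y in B].

Definition lie_subring A : Prop :=
  additive_subgroup A /\ forall x y, A x -> A y -> A (lie x y).

Definition lie_ideal I : Prop :=
  additive_subgroup I /\ forall x y, I y -> I (lie x y).

Fixpoint derived_series A (n : nat) : set r :=
  if n is n'.+1 then lie_span (derived_series A n') (derived_series A n')
  else A.

Fixpoint lower_central_series A (n : nat) : set r :=
  if n is n'.+1 then lie_span A (lower_central_series A n') else A.

Definition soluble A : Prop := exists n, derived_series A n = [set 0].

Definition nilpotent A : Prop := exists n, lower_central_series A n = [set 0].

Definition ad_nilpotent (a : r) : Prop :=
  exists n, forall x : r, iter n (lie a) x = 0.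

End LieRingTheory.

(** ** Lie rings definable in a structure *)

(* A Lie ring definable in [M], up to isomorphism: a definable subset of some
   [M^k] whose addition and bracket have definable graphs. *)
Record lie_definable_in L (M : structure L) (r : lieRingType) := LieDefinableIn {
  chart_dim : nat;
  chart : r -> ('I_chart_dim -> M);
  chart_inj : injective chart;
  chart_definable : definable (range chart);
  add_definable : definable
    [set fcat (fcat (chart x) (chart y)) (chart (x + y))
      | x in [set: r] & y in [set: r]];
  lie_definable : definable
    [set fcat (fcat (chart x) (chart y)) (chart (lie x y))
      | x in [set: r] & y in [set: r]] }.

Arguments chart_dim {L M r} _.
Arguments chart {L M r} _ _ _.

Section Definability.
Variables (L : language) (M : structure L) (r : lieRingType).
Variable D : lie_definable_in M r.
Implicit Types A F : set r.

Definition definable_set A : Prop := definable (chart D @` A).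

Definition connected A : Prop :=
  forall H : set r, definable_set H -> additive_subgroup H -> H `<=` A ->
    finite_index H A -> H = A.

Definition dcn_ideal F : Prop :=
  [/\ lie_ideal F, definable_set F, connected F & nilpotent F].

Definition largest_dcn_ideal F : Prop :=
  dcn_ideal F /\ forall I, dcn_ideal I -> I `<=` F.

End Definability.

(* Main.v *)
Require Import Defs.
From HB Require Import structures.
From mathcomp Require Import all_boot all_algebra.
From mathcomp Require Import boolp classical_sets.

Set Implicit Arguments.
Unset Strict Implicit.
Unset Printing Implicit Defensive.

Import GRing.Theory.
Local Open Scope classical_set_scope.
Local Open Scope ring_scope.

(** Finite Morley rank enters only through two chain conditions on definable
    subgroups: there is no infinite strictly descending chain, and no chain of
    more than [rk] steps of infinite index.

    The core is a commutation theorem for a connected group [V] of exponent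
    [p > rk] that is minimal under a set [S] of definable endomorphisms.  Let
    [AA] be a commutative ring of definable endomorphisms normalised by [S].
    Every [s] in [S] induces a derivation of [AA], so the [p]-th powers of [AA]
    commute with [S], and by minimality are zero or surjective with finite
    kernel.  A nilpotent element has nilpotency index at most [rk < p], so the
    nilradical is stable under the derivations; its common kernel is infinite
    and [S]-invariant, hence everything, and [AA] is a domain.  If [AA] contains
    a nonzero connected family [A1], the ideal [J] that it generates is, by
    evaluation at a vector, a definable subgroup of [V].  The chain
    [J >= J^p >= J^(p^2) >= ...] stabilises, so [J] is perfect and therefore
    commutes with [S], and so does [AA].

    For a minimal section [W / B] of [r] the theorem is used twice: it makes the
    last nontrivially acting term of the derived series central, and then,
    applied to two elements of the preceding term, it kills their commutator.
    So [r'] sends each [B_(i+1)] into [B_i] along a chain of minimal ideals, and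
    [F] is the connected component of the set of all elements that do so.  An
    ad-nilpotent [a] acts on [B_(i+1) / B_i] as an [r]-endomorphism that is not
    surjective, hence as zero. *)

(** * Definability calculus *)

Section Renaming.
Variable L : language.

Fixpoint rename_term n m (s : 'I_n -> 'I_m) (t : term L n) : term L m :=
  match t with
  | TVar i => TVar L (s i)
  | TApp f args => TApp (fun j => rename_term s (args j))
  end.

Definition lift_renaming n m (s : 'I_n -> 'I_m) : 'I_n.+1 -> 'I_m.+1 :=
  fun i => if unlift ord0 i is Some j then lift ord0 (s j) else ord0.

Fixpoint rename n (phi : formula L n) :
    forall m, ('I_n -> 'I_m) -> formula L m :=
  match phi in formula _ n return forall m, ('I_n -> 'I_m) -> formula L m with
  | FEq _ t u => fun m s => FEq (rename_term s t) (rename_term s u)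
  | FRel _ R args => fun m s => FRel (fun j => rename_term s (args j))
  | FFalse _ => fun m s => FFalse L m
  | FImp _ phi psi => fun m s => FImp (rename phi s) (rename psi s)
  | FAll _ phi => fun m s => FAll (rename phi (lift_renaming s))
  end.

Variable M : structure L.

Lemma teval_rename n m (s : 'I_n -> 'I_m) (e : 'I_m -> M) t :
  teval e (rename_term s t) = teval (e \o s) t.
Proof.
elim: t => [i|f args IH] //=; congr finterp.
by apply: funext => j; exact: IH.
Qed.

Lemma sat_rename n (phi : formula L n) m (s : 'I_n -> 'I_m) (e : 'I_m -> M) :
  sat (rename phi s) e <-> sat phi (e \o s).
Proof.
elim: phi m s e => {n} [n t u|n R args|n|n phi IHphi psi IHpsi|n phi IH] m s e /=.
- by rewrite !teval_rename.
- by under eq_fun do rewrite teval_rename.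
- by [].
- by rewrite IHphi IHpsi.
- have eqe x : fcons x e \o lift_renaming s = fcons x (e \o s).
    apply: funext => i; rewrite /= /fcons /lift_renaming.
    by case: (unlift ord0 i) => [j|]; rewrite ?liftK ?unlift_none.
  by split => H x; have := H x; rewrite IH eqe.
Qed.

End Renaming.

Definition extend T X (x : T) (e : X -> T) : option X -> T :=
  fun o => if o is Some y then e y else x.

Definition join_env T X Y (e : X -> T) (f : Y -> T) : X + Y -> T :=
  fun z => match z with inl x => e x | inr y => f y end.

Lemma split_lshift m n (i : 'I_m) : split (lshift n i) = inl i.
Proof. exact: (unsplitK (inl i)). Qed.

Lemma split_rshift m n (i : 'I_n) : split (rshift m i) = inr i.
Proof. exact: (unsplitK (inr i)). Qed.

(* Relations on [M] whose variables are named by an arbitrary type [X];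
   variables and constants are treated uniformly by the valuation [s], so that
   renaming variables does not touch the formula. *)
Section NamedVariables.
Variables (L : language) (M : structure L) (m0 : M).

Definition mvalue X (e : X -> M) (z : X + M) : M :=
  match z with inl x => e x | inr c => c end.

Definition mdef X (P : (X -> M) -> Prop) : Prop :=
  exists n (phi : formula L n) (s : 'I_n -> X + M),
    forall e, P e <-> sat phi (mvalue e \o s).

Lemma mdef_ext X (P Q : (X -> M) -> Prop) :
  (forall e, P e <-> Q e) -> mdef P -> mdef Q.
Proof.
by move=> PQ [n [phi [s H]]]; exists n, phi, s => e; rewrite -PQ.
Qed.

Lemma mdef_reindex X Y (f : X -> Y) (P : (X -> M) -> Prop) :
  mdef P -> mdef (fun e => P (e \o f)).
Proof.
move=> [n [phi [s H]]]; exists n, phi.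
exists (fun i => match s i with inl x => inl (f x) | inr c => inr c end) => e.
rewrite H; suff -> : mvalue (e \o f) \o s = mvalue e \o (fun i =>
  match s i with inl x => inl (f x) | inr c => inr c end) by [].
by apply: funext => i /=; case: (s i).
Qed.

Lemma mdef_eq X (x y : X + M) : mdef (fun e => mvalue e x = mvalue e y).
Proof.
exists 2%N, (FEq (TVar L ord0) (TVar L ord_max)).
by exists (fun i : 'I_2 => if i == ord0 then x else y) => e.
Qed.

Lemma mdef_false X : mdef (fun _ : X -> M => False).
Proof. by exists 0%N, (FFalse L 0), (fun=> inr m0) => e. Qed.

Lemma mdef_imp X (P Q : (X -> M) -> Prop) :
  mdef P -> mdef Q -> mdef (fun e => P e -> Q e).
Proof.
move=> [n [phi [s Hs]]] [m [psi [t Ht]]].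
exists (n + m)%N, (FImp (rename phi (lshift m)) (rename psi (@rshift n m))).
exists (fun i => match split i with inl j => s j | inr j => t j end) => e /=.
rewrite Hs Ht !sat_rename; set u := fun i : 'I_(n + m) => _.
have -> : (mvalue e \o u) \o lshift m = mvalue e \o s.
  by apply: funext => i; rewrite /u /= split_lshift.
suff -> : (mvalue e \o u) \o @rshift n m = mvalue e \o t by [].
by apply: funext => i; rewrite /u /= split_rshift.
Qed.

Lemma mdef_all X (P : (option X -> M) -> Prop) :
  mdef P -> mdef (fun e => forall x, P (extend x e)).
Proof.
move=> [n [phi [s Hs]]].
(* All positions valued at the bound variable [None] merge into the quantified variable [0], and the
   others move up by one. The vacated positions no longer occur, so [m0] below is only a filler. *)
pose f i := if s i is inl None then ord0 else lift ord0 i.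
exists n, (FAll (rename phi f)).
exists (fun i => match s i with
  | inl (Some x) => inl x | inl None => inr m0 | inr c => inr c end) => e /=.
set t := fun i : 'I_n => _.
suff E x : mvalue (extend x e) \o s = fcons x (mvalue e \o t) \o f.
  by split=> H x; have := H x; rewrite sat_rename Hs E.
apply: funext => i; rewrite /= /fcons /f /t.
case E: (s i) => [[y|]|c] /=; rewrite ?unlift_none ?liftK //= E //.
Qed.

Lemma mdef_not X (P : (X -> M) -> Prop) : mdef P -> mdef (fun e => ~ P e).
Proof. by move=> HP; apply: mdef_imp => //; exact: mdef_false. Qed.

Lemma mdef_and X (P Q : (X -> M) -> Prop) :
  mdef P -> mdef Q -> mdef (fun e => P e /\ Q e).
Proof.
move=> HP HQ.
apply: mdef_ext (mdef_not (mdef_imp HP (mdef_not HQ))) => e.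
split; last by move=> [p q] /(_ p).
by move=> H; split; apply: contrapT => N; apply: H.
Qed.

Lemma mdef_ex X (P : (option X -> M) -> Prop) :
  mdef P -> mdef (fun e => exists x, P (extend x e)).
Proof.
move=> HP; apply: mdef_ext (mdef_not (mdef_all (mdef_not HP))) => e.
split; last by move=> [x Px] /(_ x).
by move=> H; apply: contrapT => N; apply: H => x Px; apply: N; exists x.
Qed.

Lemma mdef_ex_block k X (P : (X + 'I_k -> M) -> Prop) :
  mdef P -> mdef (fun e => exists y, P (join_env e y)).
Proof.
elim: k X P => [|k IH] X P HP.
  pose f (z : X + 'I_0) : X :=
    match z with inl x => x | inr i => False_rect _ (notF (ltn_ord i)) end.
  have E e (y : 'I_0 -> M) : join_env e y = e \o f.
    by apply: funext => -[x|[]].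
  apply: mdef_ext (mdef_reindex f HP) => e; split.
    by move=> H; exists (fun=> m0); rewrite E.
  by move=> [y]; rewrite E.
pose f (z : X + 'I_k.+1) : option X + 'I_k :=
  match z with
  | inl x => inl (Some x)
  | inr i => if unlift ord0 i is Some j then inr j else inl None
  end.
have E x e (y : 'I_k -> M) : join_env (extend x e) y \o f = join_env e (fcons x y).
  by apply: funext => -[z|i] //=; rewrite /fcons; case: (unlift ord0 i).
apply: mdef_ext (mdef_ex (IH _ _ (mdef_reindex f HP))) => e; split.
  by move=> [x [y]]; rewrite E => H; exists (fcons x y).
move=> [y Hy]; exists (y ord0), (y \o lift ord0); rewrite E.
suff -> : fcons (y ord0) (y \o lift ord0) = y by [].
by apply: funext => i; rewrite /fcons; case: unliftP => [j|] ->.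
Qed.

Lemma mdef_all_ord X n (P : 'I_n -> (X -> M) -> Prop) :
  (forall i, mdef (P i)) -> mdef (fun e => forall i, P i e).
Proof.
elim: n P => [|n IH] P HP.
  (* The empty conjunction is encoded as [False -> False]. *)
  by apply: mdef_ext (mdef_imp (@mdef_false X) (@mdef_false X)) => e; split=> // _ [].
apply: mdef_ext (mdef_and (HP ord0) (IH _ (fun i => HP (lift ord0 i)))) => e.
by split=> [[H0 H] i|H]; [case: (unliftP ord0 i) => [j|] ->|].
Qed.

Lemma definable_mdef k (A : set ('I_k -> M)) : definable A -> mdef A.
Proof.
move=> [m [phi [b ->]]]; exists (k + m)%N, phi.
exists (fun i => match split i with inl j => inl j | inr j => inr (b j) end) => e.
rewrite /solutions /=; suff -> : fcat e b = mvalue e \o (fun i =>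
  match split i with inl j => inl j | inr j => inr (b j) end) by [].
by apply: funext => i; rewrite /fcat /=; case: (split i).
Qed.

Lemma mdef_definable k (A : set ('I_k -> M)) : mdef A -> definable A.
Proof.
move=> [n [phi [s H]]].
(* Each of the [n] positions gets its own parameter slot. The slot of a position holding a variable
   is never read and is filled with [m0]. *)
pose f i := if s i is inl x then lshift n x else rshift k i.
exists n, (rename phi f), (fun i => if s i is inr c then c else m0).
apply/seteqP; split=> e; rewrite /solutions /= sat_rename; last first.
  move=> He; apply/H; congr sat: He; apply: funext => i.
  rewrite /= /fcat /f; case E: (s i) => [x|c] /=; rewrite ?split_lshift ?split_rshift //.
  by rewrite E.
move/H; congr sat; apply: funext => i.
rewrite /= /fcat /f; case E: (s i) => [x|c] /=; rewrite ?split_lshift ?split_rshift //.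
by rewrite E.
Qed.

End NamedVariables.

(** * Definable relations and functions on a Lie ring, through its chart *)

Section LieDefinability.
Variables (L : language) (M : structure L) (r : lieRingType).
Variables (D : lie_definable_in M r) (m0 : M).
Let k := chart_dim D.

Definition flatten X (v : X -> r) : X * 'I_k -> M :=
  fun z => chart D (v z.1) z.2.

(* Nothing is required of [Q] at valuations outside the range of the chart. *)
Definition rdef X (P : (X -> r) -> Prop) : Prop :=
  exists Q : (X * 'I_k -> M) -> Prop,
    mdef Q /\ forall v, P v <-> Q (flatten v).

Lemma rdef_ext X (P Q : (X -> r) -> Prop) :
  (forall v, P v <-> Q v) -> rdef P -> rdef Q.
Proof. by move=> PQ [R [mR H]]; exists R; split => // v; rewrite -PQ. Qed.

Lemma rdef_reindex X Y (f : X -> Y) (P : (X -> r) -> Prop) :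
  rdef P -> rdef (fun v => P (v \o f)).
Proof.
move=> [Q [mQ H]].
exists (fun e => Q (e \o (fun z => (f z.1, z.2)))); split; first exact: mdef_reindex.
by move=> v; rewrite H.
Qed.

Lemma rdef_and X (P Q : (X -> r) -> Prop) :
  rdef P -> rdef Q -> rdef (fun v => P v /\ Q v).
Proof.
move=> [P' [mP HP]] [Q' [mQ HQ]]; exists (fun e => P' e /\ Q' e).
by split; [exact: mdef_and|move=> v; rewrite HP HQ].
Qed.

(** A quantifier over [r] becomes a block of [k] quantifiers over [M], relativised to the range of
    the chart because [Q] is arbitrary elsewhere. *)
Lemma rdef_ex X (P : (option X -> r) -> Prop) :
  rdef P -> rdef (fun v => exists x, P (extend x v)).
Proof.
move=> [Q [mQ HQ]].
pose f (z : option X * 'I_k) : X * 'I_k + 'I_k :=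
  if z.1 is Some x then inl (x, z.2) else inr z.2.
have E x v : join_env (flatten v) (chart D x) \o f = flatten (extend x v).
  by apply: funext => -[[y|] i].
exists (fun e => exists y, range (chart D) y /\ Q (join_env e y \o f)).
split; last first.
  move=> v; split=> [[x]|[y [[x _ <-]]]].
    by rewrite HQ -E => H; exists (chart D x); split=> //; exists x.
  by rewrite E -HQ; exists x.
apply: (@mdef_ex_block _ _ m0 _ _
  (fun e => range (chart D) (e \o inr) /\ Q (e \o f))).
apply: mdef_and => //; last exact: mdef_reindex.
exact: (mdef_reindex inr (definable_mdef (chart_definable D))).
Qed.

Lemma definable_set_rdef X (x : X) A :
  definable_set D A -> rdef (fun v => A (v x)).
Proof.
move=> /definable_mdef mA; exists (fun e => (chart D @` A) (e \o (fun i => (x, i)))).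
split; first exact: (mdef_reindex (fun i => (x, i)) mA).
move=> v; change (A (v x) <-> (chart D @` A) (chart D (v x))).
by split=> [Av|[a Aa /chart_inj <- //]]; exists (v x).
Qed.

Lemma rdef_definable_set A :
  rdef (fun v : unit -> r => A (v tt)) -> definable_set D A.
Proof.
move=> [Q [mQ HQ]]; apply: (mdef_definable m0).
have mR := mdef_reindex snd mQ.
apply: mdef_ext (mdef_and m0 (definable_mdef (chart_definable D)) mR) => e.
split=> [[[x _ <-] Hx]|[x Ax <-]].
  by exists x => //; apply/(HQ (fun=> x)).
by split; [exists x | apply/(HQ (fun=> x))].
Qed.

Lemma rdef_cst X (x : X) c : rdef (fun v => v x = c).
Proof.
exists (fun e => forall i : 'I_k, mvalue e (inl (x, i)) = mvalue e (inr (chart D c i))).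
split; first by apply: (mdef_all_ord m0) => i; exact: mdef_eq.
move=> v; split=> [E i /=|H]; first by rewrite /flatten E.
by apply: (chart_inj (l := D)); apply: funext => i; exact: H.
Qed.

Lemma rdef_eq X (x y : X) : rdef (fun v => v x = v y).
Proof.
exists (fun e => forall i : 'I_k, mvalue e (inl (x, i)) = mvalue e (inl (y, i))).
split; first by apply: (mdef_all_ord m0) => i; exact: mdef_eq.
move=> v; split=> [E i /=|H]; first by rewrite /flatten E.
by apply: (chart_inj (l := D)); apply: funext => i; exact: H.
Qed.

Lemma fcat_inj T n m (x x' : 'I_n -> T) (y y' : 'I_m -> T) :
  fcat x y = fcat x' y' -> x = x' /\ y = y'.
Proof.
move=> E; split; apply: funext => i.
  by have := congr1 (fun f => f (lshift m i)) E; rewrite /fcat split_lshift.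
by have := congr1 (fun f => f (rshift n i)) E; rewrite /fcat split_rshift.
Qed.

Lemma rdef_graph X (op : r -> r -> r) (x y z : X) :
  definable [set fcat (fcat (chart D a) (chart D b)) (chart D (op a b))
    | a in [set: r] & b in [set: r]] ->
  rdef (fun v => op (v x) (v y) = v z).
Proof.
move=> /definable_mdef mA.
pose f (i : 'I_(k + k + k)) : X * 'I_k := match split i with
  | inl j => match split j with inl l => (x, l) | inr l => (y, l) end
  | inr l => (z, l) end.
eexists; split; first exact: (mdef_reindex f mA).
move=> v /=.
have -> : flatten v \o f = fcat (fcat (chart D (v x)) (chart D (v y))) (chart D (v z)).
  apply: funext => i; rewrite /fcat /flatten /f /=.
  by case: (split i) => [j|l] //; case: (split j).
split=> [<-|[a _ [b _ /fcat_inj[/fcat_inj[]]]]]; first by exists (v x) => //; exists (v y).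
by do 3 move=> /chart_inj <-.
Qed.

Lemma rdef_add X (x y z : X) : rdef (fun v => v x + v y = v z).
Proof. exact/rdef_graph/add_definable. Qed.

Lemma rdef_lie X (x y z : X) : rdef (fun v => lie (v x) (v y) = v z).
Proof. exact/rdef_graph/lie_definable. Qed.

Definition rdfun (f : r -> r) : Prop :=
  rdef (fun v : bool -> r => v true = f (v false)).

Lemma rdfun_id : rdfun id.
Proof. exact: rdef_eq. Qed.

Lemma rdfun_cst c : rdfun (fun=> c).
Proof. exact: rdef_cst. Qed.

Lemma rdfun_op (op : r -> r -> r) f g :
  rdef (fun v : 'I_3 -> r => op (v (inord 0)) (v (inord 1)) = v (inord 2)) ->
  rdfun f -> rdfun g -> rdfun (fun a => op (f a) (g a)).
Proof.
move=> rop rf rg.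
(* In the doubly extended context [Some None] names the value of [f], [None] that of [g], and [so]
   embeds the two original variables. *)
pose so b : option (option bool) := Some (Some b).
have H1 := rdef_reindex (fun b => if b then None else so false) rg.
have H2 := rdef_reindex (fun b => if b then Some None else so false) rf.
have H3 := rdef_reindex
  (fun i : 'I_3 => match val i with 0%N => Some None | 1%N => None | _ => so true end) rop.
apply: rdef_ext (rdef_ex (rdef_ex (rdef_and H1 (rdef_and H2 H3)))) => v.
rewrite /= !inordK //=; split=> [[_ [_ [-> [-> <-]]]] //|E].
by exists (f (v false)), (g (v false)).
Qed.

Lemma rdfun_add f g : rdfun f -> rdfun g -> rdfun (fun a => f a + g a).
Proof. by apply: rdfun_op; exact: rdef_add. Qed.

Lemma rdfun_sub f g : rdfun f -> rdfun g -> rdfun (fun a => f a - g a).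
Proof.
apply: (@rdfun_op (fun x y => x - y)).
(* [z = x - y] is read off the graph of addition as [z + y = x]. *)
have := @rdef_add 'I_3 (inord 2) (inord 1) (inord 0).
by apply: rdef_ext => v; split=> [<-|<-]; rewrite ?addrK ?subrK.
Qed.

Lemma rdfun_lie f g : rdfun f -> rdfun g -> rdfun (fun a => lie (f a) (g a)).
Proof. by apply: rdfun_op; exact: rdef_lie. Qed.

Lemma rdfun_comp f g : rdfun f -> rdfun g -> rdfun (f \o g).
Proof.
move=> rf rg.
have H1 := rdef_reindex (fun b => if b then None else Some false) rg.
have H2 := rdef_reindex (fun b => if b then Some true else None) rf.
apply: rdef_ext (rdef_ex (rdef_and H1 H2)) => v /=.
by split=> [[_ [-> ->]] //|E]; exists (g (v false)).
Qed.

Lemma definable_setI A B :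
  definable_set D A -> definable_set D B -> definable_set D (A `&` B).
Proof.
by move=> dA dB; apply: rdef_definable_set; apply: rdef_and; exact: definable_set_rdef.
Qed.

Lemma definable_set_image f A :
  rdfun f -> definable_set D A -> definable_set D (f @` A).
Proof.
move=> rf dA; apply: rdef_definable_set.
have H1 := rdef_reindex (fun b => if b then Some tt else None) rf.
have H2 := definable_set_rdef (None : option unit) dA.
apply: rdef_ext (rdef_ex (rdef_and H2 H1)) => v /=.
by split=> [[x [Ax E]]|[x Ax E]]; exists x.
Qed.

Lemma definable_set_preimage f A :
  rdfun f -> definable_set D A -> definable_set D (f @^-1` A).
Proof.
move=> rf dA; apply: rdef_definable_set.
have H1 := rdef_reindex (fun b => if b then None else Some tt) rf.
have H2 := definable_set_rdef (None : option unit) dA.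
apply: rdef_ext (rdef_ex (rdef_and H2 H1)) => v /=.
by split=> [[x [Ax <-]]|Ax] //; exists (f (v tt)).
Qed.

Lemma definable_set_sum A B : definable_set D A -> definable_set D B ->
  definable_set D [set x + y | x in A & y in B].
Proof.
move=> dA dB; apply: rdef_definable_set.
have H1 := definable_set_rdef (None : option (option unit)) dA.
have H2 := definable_set_rdef (Some None : option (option unit)) dB.
have H3 := rdef_add (None : option (option unit)) (Some None) (Some (Some tt)).
apply: rdef_ext (rdef_ex (rdef_ex (rdef_and H1 (rdef_and H2 H3)))) => v /=.
split=> [[y [x [Ax [By E]]]]|[x Ax [y By E]]]; last by exists y, x.
by exists x => //; exists y.
Qed.

Lemma definable_set1 c : definable_set D [set c].
Proof. by apply: rdef_definable_set; exact: rdef_cst. Qed.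

Lemma definable_setT : definable_set D [set: r].
Proof. exact: chart_definable. Qed.

End LieDefinability.

(** * Rank bounds *)

Section Transfer.
Variables (L : language) (M N : structure L) (h : M -> N).
Hypothesis h_elem : elementary_embedding h.

Fixpoint forall_block k m : formula L (k + m) -> formula L m :=
  match k return formula L (k + m) -> formula L m with
  | 0%N => fun phi => phi
  | k'.+1 => fun phi => forall_block (FAll (phi : formula L (k' + m).+1))
  end.

Lemma fcons_fcat T k m (x0 : T) (x : 'I_k -> T) (b : 'I_m -> T) :
  fcons x0 (fcat x b) = fcat (fcons x0 x) b :> ('I_(k + m).+1 -> T).
Proof.
apply: funext => i; rewrite /fcons.
case: (unliftP ord0 i) => [j|] ->.
  rewrite /fcat; case: (splitP j) => [l jl|l jl].
    have -> : lift ord0 j = lshift m (lift ord0 l) by apply: val_inj; rewrite /= jl.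
    by rewrite split_lshift liftK.
  have -> : lift ord0 j = rshift k.+1 l by apply: val_inj; rewrite /= /bump jl addSn.
  by rewrite split_rshift.
have -> : ord0 = lshift m (ord0 : 'I_k.+1) :> 'I_(k + m).+1 by exact: val_inj.
by rewrite /fcat split_lshift unlift_none.
Qed.

Lemma sat_forall_block (K : structure L) k m (phi : formula L (k + m))
    (b : 'I_m -> K) :
  sat (forall_block phi) b <-> forall x : 'I_k -> K, sat phi (fcat x b).
Proof.
elim: k phi => [|k IH] phi /=.
  have E (x : 'I_0 -> K) : fcat x b = b.
    apply: funext => i; rewrite /fcat.
    have -> : i = rshift 0 i by exact: val_inj.
    by rewrite split_rshift; congr b; exact: val_inj.
  by split=> [H x|/(_ (fun i => match notF (ltn_ord i) with end))]; rewrite E.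
rewrite IH /=; split=> [H x|H x x0]; last by rewrite fcons_fcat.
have -> : x = fcons (x ord0) (x \o lift ord0).
  by apply: funext => i; rewrite /fcons; case: unliftP => [j|] ->.
by have := H (x \o lift ord0) (x ord0); rewrite fcons_fcat.
Qed.

Lemma transfer_forall k m (phi : formula L (k + m)) (b : 'I_m -> M) :
  (forall x, sat phi (fcat x b)) <-> (forall x, sat phi (fcat x (h \o b))).
Proof. by rewrite -!sat_forall_block; exact: h_elem. Qed.

(** Pooling the two parameter tuples turns the inclusion into one universally quantified formula, to
    which elementarity applies. *)
Lemma transfer_imp k m1 m2 (phi : formula L (k + m1)) (psi : formula L (k + m2))
    (b : 'I_m1 -> M) (c : 'I_m2 -> M) :
  (forall x, sat phi (fcat x b) -> sat psi (fcat x c)) ->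
  forall x, sat phi (fcat x (h \o b)) -> sat psi (fcat x (h \o c)).
Proof.
pose s1 (i : 'I_(k + m1)) : 'I_(k + (m1 + m2)) :=
  match split i with inl j => lshift _ j | inr j => rshift k (lshift m2 j) end.
pose s2 (i : 'I_(k + m2)) : 'I_(k + (m1 + m2)) :=
  match split i with inl j => lshift _ j | inr j => rshift k (rshift m1 j) end.
have E1 T (x : 'I_k -> T) b' c' : fcat x (fcat b' c') \o s1 = fcat x b'.
  apply: funext => i; rewrite /= /s1 /fcat; case: (split i) => j;
  by rewrite ?split_lshift ?split_rshift ?split_lshift.
have E2 T (x : 'I_k -> T) b' c' : fcat x (fcat b' c') \o s2 = fcat x c'.
  apply: funext => i; rewrite /= /s2 /fcat; case: (split i) => j;
  by rewrite ?split_lshift ?split_rshift ?split_rshift.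
have E3 : h \o fcat b c = fcat (h \o b) (h \o c).
  by apply: funext => i; rewrite /= /fcat; case: (split i).
have := transfer_forall (FImp (rename phi s1) (rename psi s2)) (fcat b c).
rewrite E3 => -[H _] H1 x.
have := H _ x => /=; rewrite !sat_rename E1 E2; apply=> y /=.
by rewrite !sat_rename E1 E2; exact: H1.
Qed.

(** Nonemptiness, inclusion and disjointness of definable sets are first order, so a tree of
    definable sets witnessing the rank in [M] is carried to one in [N]. *)
Lemma rank_ge_transfer d k m (phi : formula L (k + m)) (b : 'I_m -> M) :
  rank_ge d (solutions phi b) -> rank_ge d (solutions phi (h \o b)).
Proof.
elim: d k m phi b => [|d IH] k m phi b /=.
  move=> [x xphi]; apply: contrapT => N0.
  have /transfer_forall/(_ x)/(_ xphi) // :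
    forall y, sat (FImp phi (FFalse L _)) (fcat y (h \o b)).
  by move=> y /= ?; apply: N0; exists y.
move=> [Y [dY YX tY rY]].
(* The number of parameters varies with [i], so it is packed with the formula and the parameters
   into a single type. *)
have /choice[z Hz] : forall i, exists z : {m' : nat & (formula L (k + m') * ('I_m' -> M))%type},
    Y i = solutions (projT2 z).1 (projT2 z).2.
  move=> i; have [m' [psi [c E]]] := dY i.
  exact: (ex_intro _ (existT _ m' (psi, c)) E).
exists (fun i => solutions (projT2 (z i)).1 (h \o (projT2 (z i)).2)); split.
- by move=> i; do 3 eexists.
- move=> i; refine (transfer_imp _) => x H.
  by apply: (YX i); rewrite Hz.
- move=> i j _ _ [x [xi xj]]; apply: contrapT => ij.
  have H : forall y, sat (projT2 (z i)).1 (fcat y (projT2 (z i)).2) ->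
      sat (FImp (projT2 (z j)).1 (FFalse L _)) (fcat y (projT2 (z j)).2).
    move=> y yi /= yj; apply: ij; apply: (tY i j) => //.
    by exists y; rewrite !Hz.
  exact: (transfer_imp H xi xj).
- by move=> i; apply: IH; rewrite -Hz.
Qed.

End Transfer.

(** The rank computed inside [M], which may fail to be saturated, is at most the Morley rank. From
    here on all computations stay in [M]. *)
Lemma morley_rank_bound L (M : structure L) k (A : set ('I_k -> M)) d :
  morley_rank A d -> ~ rank_ge d.+1 A.
Proof.
move=> [m [phi [b [-> [N [h [hE _ _ N1]]]]]]] H; apply: N1.
exact: rank_ge_transfer H.
Qed.

(** * Rank and chains of definable subgroups of a Lie ring *)

Section LieRank.
Variables (L : language) (M : structure L) (r : lieRingType).
Variables (D : lie_definable_in M r) (m0 : M).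

Definition rank_at_least d (A : set r) := rank_ge d (chart D @` A).

Lemma rank_at_leastS d (A : set r) (Y : nat -> set r) :
  (forall i, definable_set D (Y i)) -> (forall i, Y i `<=` A) ->
  trivIset setT Y -> (forall i, rank_at_least d (Y i)) ->
  rank_at_least d.+1 A.
Proof.
move=> dY YA tY rY; exists (fun i => chart D @` Y i); split=> //.
  by move=> i; exact: image_subset.
move=> i j _ _ [_ [[x Yx <-] [y Yy /chart_inj E]]].
by apply: (tY i j) => //; exists x; split=> //; rewrite -E.
Qed.

Lemma rank_at_leastSP d (A : set r) :
  rank_at_least d.+1 A -> exists Y : nat -> set r,
    [/\ forall i, definable_set D (Y i), forall i, Y i `<=` A,
        trivIset setT Y & forall i, rank_at_least d (Y i)].
Proof.
move=> [Y [dY YA tY rY]].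
have E i : chart D @` (chart D @^-1` Y i) = Y i.
  apply/seteqP; split=> [_ [x ? <-] //|e Ye].
  by have [x Ax xe] := YA _ _ Ye; exists x; rewrite //= xe.
exists (fun i => chart D @^-1` Y i); split=> [i|i x /YA[y Ay /chart_inj <-]||i] //.
- by rewrite /definable_set E; exact: dY.
- by move=> i j _ _ [x [xi xj]]; apply: (tY i j) => //; exists (chart D x).
- by rewrite /rank_at_least E; exact: rY.
Qed.

Lemma rank_at_least_sub d (A B : set r) :
  A `<=` B -> rank_at_least d A -> rank_at_least d B.
Proof.
case: d => [|d] AB; first by move=> [e [x Ax xe]]; exists e; exists x => //; exact: AB.
move=> /rank_at_leastSP[Y [dY YA tY rY]]; apply: (rank_at_leastS dY) => // i x Yx.
exact/AB/(YA i).
Qed.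

Lemma rank_at_least_image d f (A : set r) :
  injective f -> rdfun D f -> rank_at_least d A -> rank_at_least d (f @` A).
Proof.
move=> f_inj df; elim: d A => [|d IH] A.
  by move=> [e [x Ax xe]]; exists (chart D (f x)); exists (f x) => //; exists x.
move=> /rank_at_leastSP[Y [dY YA tY rY]].
apply: (@rank_at_leastS _ _ (fun i => f @` Y i)) => [i|i|i j _ _|i].
- exact: definable_set_image.
- exact: image_subset.
- by move=> [_ [[x Yx <-] [y Yy /f_inj E]]]; apply: (tY i j) => //; exists x; split=> //; rewrite -E.
- exact: IH.
Qed.

Lemma rank_at_least_coset d (A : set r) x :
  rank_at_least d A -> rank_at_least d [set x + a | a in A].
Proof.
apply: rank_at_least_image => [a b /addrI //|].
exact: (rdfun_add (f := fun=> x) (g := id) m0 (rdfun_cst _ m0 x) (rdfun_id _ m0)).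
Qed.

Lemma definable_coset A x :
  definable_set D A -> definable_set D [set x + a | a in A].
Proof.
apply: (definable_set_image m0); exact: (rdfun_add (f := fun=> x) (g := id) m0 (rdfun_cst _ m0 x) (rdfun_id _ m0)).
Qed.

(* Cosets of [A n.+1] contained in the differences [A n \ A n.+1] raise the rank. *)
Lemma rank_descending (A : nat -> set r) d n :
  (forall n, definable_set D (A n)) -> (forall n, additive_subgroup (A n)) ->
  (forall n, A n.+1 `<=` A n) -> (forall n, A n.+1 <> A n) ->
  rank_at_least d (A n).
Proof.
move=> dA sA AS Aneq.
have decr i j : (i <= j)%N -> A j `<=` A i.
  move=> /subnK <-; elim: (j - i)%N => [|l IH] //; exact: subset_trans (AS _) IH.
have /choice[x Hx] : forall i, exists x, A i x /\ ~ A i.+1 x.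
  move=> i; apply: contrapT => N; apply: (Aneq i); apply/seteqP; split=> // x Ax.
  by apply: contrapT => NA; apply: N; exists x.
elim: d n => [|d IH] n.
  by exists (chart D 0); exists 0 => //; case: (sA n).
have dif i y : A i.+1 y -> A i (x i + y) /\ ~ A i.+1 (x i + y).
  move=> Ay; have [A0 Asub] := sA i; have [_ Asub'] := sA i.+1; have [xi Nxi] := Hx i; split.
    rewrite -[y]opprK; apply: (Asub) => //; rewrite -sub0r; apply: (Asub) => //; exact: AS.
  by move=> H; apply: Nxi; rewrite -(addrK y (x i)); exact: Asub'.
apply: (@rank_at_leastS _ _ (fun i => [set x (n + i)%N + a | a in A (n + i).+1])).
- by move=> i; exact: definable_coset.
- move=> i _ [a Aa <-]; apply: (decr _ (n + i)%N); first exact: leq_addr.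
  by have [] := dif _ _ Aa.
- move=> i j _ _ [_ [[a Aa <-] [b Ab E]]].
  have [Ha Na] := dif _ _ Aa; have [Hb Nb] := dif _ _ Ab.
  case: (ltngtP i j) => // ij; case: notF.
    by case: Na; rewrite -E; apply: (decr _ (n + j)%N) Hb; rewrite ltn_add2l.
  by case: Nb; rewrite E; apply: (decr _ (n + i)%N) Ha; rewrite ltn_add2l.
- by move=> i; exact: rank_at_least_coset.
Qed.

(** [B] contains infinitely many disjoint cosets of [A], each of rank at least [d] by
    translation. *)
Lemma rank_infinite_index d (A B : set r) :
  definable_set D A -> additive_subgroup A -> additive_subgroup B ->
  A `<=` B -> ~ finite_index A B -> rank_at_least d A -> rank_at_least d.+1 B.
Proof.
move=> dA [A0 AB] [B0 BB] AsB Nfin rA.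
have /choice[g Hg] : forall s : seq r, exists x, B x /\ forall y, y \in s -> ~ A (x - y).
  move=> s; apply: contrapT => N; apply: Nfin; exists s => x Bx.
  apply: contrapT => N2; apply: N; exists x; split=> // y ys Axy.
  by apply: N2; exists y.
(* [s n] lists the first [n] representatives; [g] picks the next one outside their cosets. *)
pose s := fix s n := if n is m.+1 then g (s m) :: s m else [::].
have sS i j : (i < j)%N -> g (s i) \in s j.
  elim: j => // j IH; rewrite ltnS leq_eqVlt => /orP[/eqP ->|/IH H].
    by rewrite /= inE eqxx.
  by rewrite /= inE H orbT.
apply: (@rank_at_leastS _ _ (fun i => [set g (s i) + a | a in A])).
- by move=> i; exact: definable_coset.
- move=> i _ [a Aa <-]; have [Bg _] := Hg (s i).
  rewrite -[a]opprK; apply: (BB) => //; rewrite -sub0r; apply: (BB) => //; exact: AsB.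
- have key i j a b : (i < j)%N -> A a -> A b -> g (s j) + b <> g (s i) + a.
    move=> /sS ij Aa Ab E; have [_ /(_ _ ij)] := Hg (s j); apply.
    have -> : g (s j) - g (s i) = a - b.
      by apply/eqP; rewrite subr_eq addrAC eq_sym subr_eq E addrC.
    exact: AB.
  move=> i j _ _ [_ [[a Aa <-] [b Ab E]]].
  by case: (ltngtP i j) => // ij; [case: (key i j a b)|case: (key j i b a)].
- by move=> i; exact: rank_at_least_coset.
Qed.

Lemma rank_ascending (A : nat -> set r) n :
  (forall i, (i <= n)%N -> definable_set D (A i) /\ additive_subgroup (A i)) ->
  (forall i, (i < n)%N -> A i `<=` A i.+1 /\ ~ finite_index (A i) (A i.+1)) ->
  rank_at_least n (A n).
Proof.
elim: n => [|n IH] dA iA.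
  by exists (chart D 0); exists 0 => //; case: (dA 0%N) => // _ [].
have [d1 s1] := dA n (leqnSn n); have [d2 s2] := dA n.+1 (leqnn _).
have [A12 N] := iA n (leqnn _).
apply: rank_infinite_index N _ => //.
by apply: IH => i Hi; [apply: dA|apply: iA]; exact: (leq_trans Hi (leqnSn n)).
Qed.

End LieRank.

(** * Subgroups, indices and endomorphisms *)

Section Subgroups.
Variable V : zmodType.
Implicit Types A B C : set V.

Lemma subgroup0 A : additive_subgroup A -> A 0.
Proof. by case. Qed.

Lemma subgroupB A x y : additive_subgroup A -> A x -> A y -> A (x - y).
Proof. by case=> _; apply. Qed.

Lemma subgroupN A x : additive_subgroup A -> A x -> A (- x).
Proof. by move=> sA Ax; rewrite -sub0r; apply: subgroupB => //; exact: subgroup0. Qed.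

Lemma subgroupD A x y : additive_subgroup A -> A x -> A y -> A (x + y).
Proof. by move=> sA Ax Ay; rewrite -[y]opprK; apply: subgroupB => //; exact: subgroupN. Qed.

Lemma subgroupT : additive_subgroup [set: V].
Proof. by []. Qed.

Lemma subgroup1 : additive_subgroup [set 0 : V].
Proof. by split=> // _ _ -> ->; rewrite subr0. Qed.

Lemma subgroupI A B :
  additive_subgroup A -> additive_subgroup B -> additive_subgroup (A `&` B).
Proof.
move=> sA sB; split; first by split; exact: subgroup0.
by move=> x y [? ?] [? ?]; split; exact: subgroupB.
Qed.

Definition sum_set A B : set V := [set x + y | x in A & y in B].

Lemma subgroup_sum A B :
  additive_subgroup A -> additive_subgroup B -> additive_subgroup (sum_set A B).
Proof.
move=> sA sB; split.
  by exists 0; [exact: subgroup0|exists 0; [exact: subgroup0|rewrite addr0]].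
move=> _ _ [a Aa [b Bb <-]] [a' Aa' [b' Bb' <-]].
exists (a - a'); first exact: subgroupB.
by exists (b - b'); [exact: subgroupB|rewrite opprD addrACA].
Qed.

Lemma sum_setl A B : additive_subgroup B -> A `<=` sum_set A B.
Proof. by move=> sB x Ax; exists x => //; exists 0; [exact: subgroup0|rewrite addr0]. Qed.

Lemma sum_setr A B : additive_subgroup A -> B `<=` sum_set A B.
Proof. by move=> sA x Bx; exists 0; [exact: subgroup0|exists x => //; rewrite add0r]. Qed.

Lemma sum_set_sub A B C :
  additive_subgroup C -> A `<=` C -> B `<=` C -> sum_set A B `<=` C.
Proof. by move=> sC AC BC _ [a /AC Ca [b /BC Cb <-]]; exact: subgroupD. Qed.

Lemma finite_index_sub A B C : finite_index A B -> C `<=` B -> finite_index A C.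
Proof. by move=> [s H] CB; exists s => x /CB /H. Qed.

Lemma finite_index_trans A B C :
  finite_index A B -> finite_index B C -> finite_index A C.
Proof.
move=> [s Hs] [t Ht]; exists [seq y + z | y <- t, z <- s] => x Cx.
have [y yt Bxy] := Ht _ Cx; have [z zs Axyz] := Hs _ Bxy.
by exists (y + z); [apply/allpairsP; exists (y, z)|rewrite opprD addrA].
Qed.

End Subgroups.

Lemma finite_index_preimage (V W : zmodType) (f : V -> W) A B :
  (forall x y, B x -> B y -> f (x - y) = f x - f y) ->
  additive_subgroup A -> additive_subgroup B ->
  finite_index A (f @` B) -> finite_index ((f @^-1` A) `&` B) B.
Proof.
move=> fB sA sB [s Hs].
(* For each representative of a coset of [A], choose an element of [B] mapped into that coset when
   there is one; otherwise [0] is a dummy. *)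
have /choice[g Hg] : forall y, exists x, (exists2 x', B x' & A (f x' - y)) ->
    B x /\ A (f x - y).
  move=> y; have [[x Bx Ax]|N] := pselect (exists2 x', B x' & A (f x' - y)).
    by exists x.
  by exists 0 => /N.
exists (map g s) => x Bx.
have [|y ys Axy] := Hs (f x); first by exists x.
have [|Bg Ag] := Hg y; first by exists x.
exists (g y); first exact: map_f.
split; last exact: subgroupB.
rewrite /preimage /= fB //; have -> : f x - f (g y) = (f x - y) - (f (g y) - y).
  by rewrite opprB addrA subrK.
exact: subgroupB.
Qed.

Lemma finite_indexI (V : zmodType) (A B : set V) :
  additive_subgroup A -> additive_subgroup B ->
  finite_index A B -> finite_index (A `&` B) B.
Proof.
by move=> sA sB fAB; apply: (finite_index_preimage (f := id)) => //; rewrite image_id.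
Qed.

(** The single law on differences yields full additivity and matches the way subgroups are
    specified. *)
Record endo (V : zmodType) := Endo {
  endo_fun :> V -> V;
  endoB : forall x y, endo_fun (x - y) = endo_fun x - endo_fun y }.

Section EndoRing.
Variable V : zmodType.
Implicit Types f g h : endo V.

Lemma endoP f g : f =1 g -> f = g.
Proof.
case: f g => [f fB] [g gB] /= /funext E; case: g / E gB => gB.
by rewrite (Prop_irrelevance fB gB).
Qed.

Lemma endo0 f : f 0 = 0.
Proof. by have := endoB f 0 0; rewrite !subrr. Qed.

Lemma endoN f x : f (- x) = - f x.
Proof. by rewrite -sub0r endoB endo0 sub0r. Qed.

Lemma endoD f x y : f (x + y) = f x + f y.
Proof. by rewrite -{1}[y]opprK endoB endoN opprK. Qed.

Fact zero_endo_subproof (x y : V) : 0 = 0 - 0 :> V.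
Proof. by rewrite subr0. Qed.
Definition zero_endo := Endo zero_endo_subproof.

Fact opp_endo_subproof f x y : - f (x - y) = - f x - - f y.
Proof. by rewrite endoB opprB addrC opprK. Qed.
Definition opp_endo f := Endo (opp_endo_subproof f).

Fact add_endo_subproof f g x y : f (x - y) + g (x - y) = f x + g x - (f y + g y).
Proof. by rewrite !endoB opprD addrACA. Qed.
Definition add_endo f g := Endo (add_endo_subproof f g).

Definition one_endo : endo V := Endo (fun x y => erefl (x - y)).

Fact mul_endo_subproof f g x y : f (g (x - y)) = f (g x) - f (g y).
Proof. by rewrite !endoB. Qed.
Definition mul_endo f g := Endo (mul_endo_subproof f g).

HB.instance Definition _ := gen_eqMixin (endo V).
HB.instance Definition _ := gen_choiceMixin (endo V).

Fact add_endoA : associative add_endo.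
Proof. by move=> f g h; apply: endoP => x /=; rewrite addrA. Qed.
Fact add_endoC : commutative add_endo.
Proof. by move=> f g; apply: endoP => x /=; rewrite addrC. Qed.
Fact add_0endo : left_id zero_endo add_endo.
Proof. by move=> f; apply: endoP => x /=; rewrite add0r. Qed.
Fact add_Nendo : left_inverse zero_endo opp_endo add_endo.
Proof. by move=> f; apply: endoP => x /=; rewrite addNr. Qed.
HB.instance Definition _ :=
  GRing.isZmodule.Build (endo V) add_endoA add_endoC add_0endo add_Nendo.

Fact mul_endoA : associative mul_endo.
Proof. by move=> f g h; apply: endoP. Qed.
Fact mul_1endo : left_id one_endo mul_endo.
Proof. by move=> f; apply: endoP. Qed.
Fact mul_endo1 : right_id one_endo mul_endo.
Proof. by move=> f; apply: endoP. Qed.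
Fact mul_endoDl : left_distributive mul_endo +%R.
Proof. by move=> f g h; apply: endoP. Qed.
Fact mul_endoDr : right_distributive mul_endo +%R.
Proof. by move=> f g h; apply: endoP => x; rewrite /= endoD. Qed.
HB.instance Definition _ := GRing.Zmodule_isPzRing.Build (endo V)
  mul_endoA mul_1endo mul_endo1 mul_endoDl mul_endoDr.

Lemma endo_addE f g x : (f + g) x = f x + g x. Proof. by []. Qed.
Lemma endo_subE f g x : (f - g) x = f x - g x. Proof. by []. Qed.
Lemma endo_mulE f g x : (f * g) x = f (g x). Proof. by []. Qed.
Lemma endo_mulrnE f n x : (f *+ n) x = f x *+ n.
Proof. by elim: n => [|n IH] //; rewrite !mulrS endo_addE IH. Qed.

Lemma subgroup_endo_image f A : additive_subgroup A -> additive_subgroup (f @` A).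
Proof.
move=> sA; split; first by exists 0; rewrite ?endo0 //; exact: subgroup0.
by move=> _ _ [x Ax <-] [y Ay <-]; exists (x - y); rewrite ?endoB //; exact: subgroupB.
Qed.

Lemma subgroup_endo_preimage f A :
  additive_subgroup A -> additive_subgroup (f @^-1` A).
Proof.
move=> sA; split; first by rewrite /preimage /= endo0; exact: subgroup0.
by move=> x y Ax Ay; rewrite /preimage /= endoB; exact: subgroupB.
Qed.

Lemma finite_kernel_image f A : additive_subgroup A ->
  finite_index [set 0] (A `&` (f @^-1` [set 0])) ->
  finite_index [set 0] (f @` A) -> finite_index [set 0] A.
Proof.
move=> sA fk fi; have := finite_index_preimage (fun x y _ _ => endoB f x y)
  (@subgroup1 V) sA fi.
by rewrite setIC; exact: finite_index_trans.
Qed.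

End EndoRing.

(** The inner binomial coefficients are divisible by [p]. The ring is noncommutative and may be
    trivial, since the lemma serves in endomorphism rings. *)
Lemma exprD_pchar_comm (R : pzRingType) p (x y : R) : prime p ->
  (forall z : R, z *+ p = 0) -> GRing.comm x y -> (x + y) ^+ p = x ^+ p + y ^+ p.
Proof.
move=> p_pr p0 cxy.
rewrite exprDn_comm // big_ord_recr /= subnn.
have defp := prednK (prime_gt0 p_pr).
move: p_pr p0; rewrite -defp => p_pr p0.
rewrite big_ord_recl /= subn0 expr0 mulr1 mul1r bin0 binn big1 ?addr0 // => i _.
have /dvdnP[q ->] : (p.-1.+1 %| 'C(p.-1.+1, bump 0 i))%N by rewrite prime_dvd_bin //= /bump add1n ltnS ltn_ord.
by rewrite mulrnA p0.
Qed.

(** Applying the additive version to [(x - y) + y] avoids discussing the sign of [(- y) ^+ p]. *)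
Lemma exprB_pchar_comm (R : pzRingType) p (x y : R) : prime p ->
  (forall z : R, z *+ p = 0) -> GRing.comm x y -> (x - y) ^+ p = x ^+ p - y ^+ p.
Proof.
move=> p_pr p0 cxy.
have c : GRing.comm (x - y) y.
  by apply: commr_sym; apply: commrB => //; exact: commr_sym.
by rewrite -[in RHS](subrK y x) (exprD_pchar_comm p_pr p0 c) addrK.
Qed.

Lemma exprB_pchar_iter_comm (R : pzRingType) p n (x y : R) : prime p ->
  (forall z : R, z *+ p = 0) -> GRing.comm x y ->
  (x - y) ^+ (p ^ n) = x ^+ (p ^ n) - y ^+ (p ^ n).
Proof.
move=> p_pr p0 cxy; elim: n => [|n IH]; first by rewrite !expr1.
rewrite expnSr !exprM IH exprB_pchar_comm //.
by apply: commrX; apply: commr_sym; apply: commrX; exact: commr_sym.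
Qed.

(** * Groups with a chain condition on definable subgroups *)

(** The interface through which definability and rank are used, satisfied by [r] and inherited by
    its definable sections. The last field says that no chain of [d.+1] steps has all its indices
    infinite. *)
Record group_system (V : zmodType) (d : nat) := GroupSystem {
  dsub : set V -> Prop;
  dend : endo V -> Prop;
  dsub_subgroup : forall A, dsub A -> additive_subgroup A;
  dsubT : dsub [set: V];
  dsub1 : dsub [set 0];
  dsubI : forall A B, dsub A -> dsub B -> dsub (A `&` B);
  dsub_sum : forall A B, dsub A -> dsub B -> dsub (sum_set A B);
  dsub_image : forall f A, dend f -> dsub A -> dsub (f @` A);
  dsub_preimage : forall f A, dend f -> dsub A -> dsub (f @^-1` A);
  dend1 : dend 1;
  dendB : forall f g, dend f -> dend g -> dend (f - g);
  dendM : forall f g, dend f -> dend g -> dend (f * g);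
  dsub_descending : forall A : nat -> set V, (forall n, dsub (A n)) ->
    (forall n, A n.+1 `<=` A n) -> exists n, A n.+1 = A n;
  dsub_ascending : forall A : nat -> set V,
    (forall n, (n <= d.+1)%N -> dsub (A n)) ->
    (forall n, (n <= d)%N -> A n `<=` A n.+1) ->
    exists2 n, (n <= d)%N & finite_index (A n) (A n.+1) }.

Section GroupSystem.
Variables (V : zmodType) (d : nat) (G : group_system V d).
Implicit Types A B C H : set V.

Definition conn A : Prop :=
  dsub G A /\ forall H, dsub G H -> H `<=` A -> finite_index H A -> H = A.

Lemma conn_dsub A : conn A -> dsub G A. Proof. by case. Qed.

Lemma conn_subgroup A : conn A -> additive_subgroup A.
Proof. by move=> /conn_dsub; exact: dsub_subgroup. Qed.

Hint Resolve conn_dsub conn_subgroup : core.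

Lemma conn_sub A H : conn A -> dsub G H -> finite_index H A -> A `<=` H.
Proof.
move=> [dA cA] dH fHA; rewrite -(cA (H `&` A)) //.
  exact: dsubI.
by apply: finite_indexI => //; apply: dsub_subgroup; eassumption.
Qed.

Lemma conn0 : conn [set 0].
Proof.
split; first exact: dsub1.
move=> H dH H0 _; apply/seteqP; split=> // _ ->.
by apply: subgroup0; apply: dsub_subgroup; eassumption.
Qed.

(** Without a minimal element, choice would build an infinite strict descent from [A0]. *)
Lemma dsub_minimal (P : set V -> Prop) A0 : dsub G A0 -> P A0 ->
  exists A, [/\ dsub G A, P A, A `<=` A0 &
    forall B, dsub G B -> P B -> B `<=` A -> B = A].
Proof.
move=> dA0 PA0; apply: contrapT => N.
have /choice[g Hg] : forall A, exists B, dsub G A /\ P A /\ A `<=` A0 ->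
    (dsub G B /\ P B /\ B `<=` A0) /\ (B `<=` A /\ B <> A).
  move=> A; have [[dA [PA AA0]]|NA] := pselect (dsub G A /\ P A /\ A `<=` A0); last first.
    by exists A => /NA.
  apply: contrapT => N2; apply: N; exists A; split=> // B dB PB BA.
  apply: contrapT => BA'; apply: N2; exists B => _; split; last by [].
  by split=> //; split=> //; exact: subset_trans AA0.
have H n : dsub G (iter n g A0) /\ P (iter n g A0) /\ iter n g A0 `<=` A0.
  by elim: n => [|n /Hg[]] //=; split=> //; split.
have [n E] := dsub_descending (fun n => (H n).1)
  (fun n => (Hg _ (H n)).2.1).
by case: (Hg _ (H n)) => _ [_]; apply.
Qed.

(** A proper inclusion of connected subgroups has infinite index, so the bound on chains becomes an
    ascending chain condition. *)
Lemma conn_maximal (P : set V -> Prop) A0 : conn A0 -> P A0 ->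
  exists A, [/\ conn A, P A & forall B, conn B -> P B -> A `<=` B -> B = A].
Proof.
move=> dA0 PA0; apply: contrapT => N.
have /choice[g Hg] : forall A, exists B, conn A /\ P A ->
    (conn B /\ P B) /\ (A `<=` B /\ B <> A).
  move=> A; have [[dA PA]|NA] := pselect (conn A /\ P A); last first.
    by exists A => /NA.
  apply: contrapT => N2; apply: N; exists A; split=> // B dB PB AB.
  by apply: contrapT => BA'; apply: N2; exists B.
have H n : conn (iter n g A0) /\ P (iter n g A0).
  by elim: n => [|n /Hg[]] //=.
have [n nd fi] := dsub_ascending (fun n _ => (H n).1.1)
  (fun n _ => (Hg _ (H n)).2.1).
have [_ [sub neq]] := Hg _ (H n); apply: neq.
apply/seteqP; split=> //; apply: conn_sub fi; last exact: (H n).1.1.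
exact: (H n.+1).1.
Qed.

Lemma component A : dsub G A ->
  exists C, [/\ conn C, C `<=` A, finite_index C A &
    forall B, conn B -> B `<=` A -> B `<=` C].
Proof.
move=> dA; have fA : finite_index A A.
  by exists [:: 0] => x Ax; exists 0; rewrite ?inE ?subr0.
have [C [dC fC CA minC]] :=
  @dsub_minimal (fun C => finite_index C A) A dA fA.
have cC : conn C.
  split=> // H dH HC fH; apply: minC => //; exact: finite_index_trans fH fC.
exists C; split=> // B cB BA.
by apply: conn_sub => //; exact: finite_index_sub BA.
Qed.

Lemma conn_image f A : dend G f -> conn A -> conn (f @` A).
Proof.
move=> df cA; have dA := conn_dsub cA.
split; first exact: dsub_image.
move=> H dH HfA fH; apply/seteqP; split=> //.
have sub : A `<=` f @^-1` H `&` A.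
  apply: conn_sub => //; first by apply: dsubI => //; exact: dsub_preimage.
  apply: finite_index_preimage => //; first by move=> *; exact: endoB.
    exact: dsub_subgroup dH.
  exact: conn_subgroup.
by move=> _ [x /sub[Hx _] <-].
Qed.

Lemma conn_sum A B : conn A -> conn B -> conn (sum_set A B).
Proof.
move=> cA cB; split; first by apply: dsub_sum; exact: conn_dsub.
move=> H dH HAB fH; apply/seteqP; split=> //.
apply: sum_set_sub; first exact: dsub_subgroup dH.
  by apply: conn_sub => //; apply: finite_index_sub fH _; apply: sum_setl; exact: conn_subgroup.
by apply: conn_sub => //; apply: finite_index_sub fH _; apply: sum_setr; exact: conn_subgroup.
Qed.

Lemma conn_finite A : conn A -> finite_index [set 0] A -> A = [set 0].
Proof.
move=> cA fA; apply/seteqP; split.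
  by apply: conn_sub => //; exact: dsub1.
by move=> _ ->; apply: subgroup0; exact: conn_subgroup.
Qed.

(** By the descending chain condition the whole intersection is already a finite one, so it inherits
    any property that survives intersection with one more member. *)
Lemma dsub_bigcap_ind (I : Type) (P : I -> Prop) (F : I -> set V)
    (C : set V -> Prop) : C setT ->
  (forall A, C A -> dsub G A) ->
  (forall A i, C A -> P i -> C (A `&` F i)) ->
  C [set x | forall i, P i -> F i x].
Proof.
move=> CT Cd CF.
pose Q A := C A /\ [set x | forall i, P i -> F i x] `<=` A.
have [|A [dA [CA FA] _ minA]] := @dsub_minimal Q setT (Cd _ CT).
  by split.
suff -> : [set x | forall i, P i -> F i x] = A by [].
apply/seteqP; split=> // x Ax i Pi.
have E : A `&` F i = A.
  apply: minA; [exact/Cd/CF| |exact: subIsetl].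
  by split; [exact: CF|move=> y Fy; split; [exact: FA|exact: Fy]].
by move: Ax; rewrite -E => -[].
Qed.

Lemma dsub_bigcap (I : Type) (P : I -> Prop) (F : I -> set V) :
  (forall i, P i -> dsub G (F i)) -> dsub G [set x | forall i, P i -> F i x].
Proof.
move=> dF; apply: dsub_bigcap_ind => //; first exact: dsubT.
by move=> A i dA Pi; apply: dsubI => //; exact: dF.
Qed.

(** The dual principle: a maximal [U] with property [C] absorbs every [F i], so an infinite family
    is handled by adding one member at a time. *)
Lemma conn_sum_ind (I : Type) (P : I -> Prop) (F : I -> set V)
    (C : set V -> Prop) : C [set 0] ->
  (forall A, C A -> conn A) -> (forall i, P i -> additive_subgroup (F i)) ->
  (forall A i, C A -> P i -> C (sum_set A (F i))) ->
  exists2 U, C U & forall i, P i -> F i `<=` U.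
Proof.
move=> C0 Cc sF CF.
have [U [cU CU maxU]] := conn_maximal (Cc _ C0) C0.
exists U => // i Pi.
have <- : sum_set U (F i) = U.
  apply: maxU; [exact/Cc/CF|exact: CF|].
  by apply: sum_setl; exact: sF.
by apply: sum_setr; exact: conn_subgroup.
Qed.

(** [f] maps [C] into [A], where [C] has finite index, so the preimage of [C] has finite index in
    the connected group [C]. *)
Lemma component_invariant f A C : dend G f -> conn C -> finite_index C A ->
  C `<=` A -> (forall x, A x -> A (f x)) -> forall x, C x -> C (f x).
Proof.
move=> df cC fC CA fA.
have sub : C `<=` f @^-1` C `&` C.
  apply: conn_sub => //.
    by apply: dsubI; [apply: dsub_preimage => //|]; exact: conn_dsub.
  apply: finite_index_preimage => //; [by move=> *; exact: endoB|exact: conn_subgroup|exact: conn_subgroup|].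
  apply: finite_index_sub fC _ => _ [x Cx <-]; exact/fA/CA.
by move=> x /sub[].
Qed.

End GroupSystem.

(** * The commutation theorem *)

Lemma commutator0 (R : pzRingType) (x y : R) :
  GRing.comm x y <-> x * y - y * x = 0.
Proof. by split=> [->|/eqP]; [rewrite subrr|rewrite subr_eq0 => /eqP]. Qed.

Lemma commutator_jacobi (R : pzRingType) (x y z : R) :
  x * (y * z - z * y) - (y * z - z * y) * x =
  ((x * y - y * x) * z - z * (x * y - y * x)) +
  (y * (x * z - z * x) - (x * z - z * x) * y).
Proof.
rewrite !mulrBl !mulrBr !mulrA !opprB [RHS]addrACA !subrKA.
by rewrite addrACA [- _ + _]addrC addrACA.
Qed.

(** The power rule for the derivation induced by [s]. At [n = p] it makes [p]-th powers commute with
    [s]; at a nilpotency index it constrains [s * f - f * s]. *)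
Lemma commutator_exp (R : pzRingType) (s f : R) n :
  GRing.comm f (s * f - f * s) ->
  s * f ^+ n - f ^+ n * s = f ^+ n.-1 * (s * f - f * s) *+ n.
Proof.
move=> cf; elim: n => [|n IH]; first by rewrite expr0 mulr1 mul1r subrr mulr0n.
have -> : s * f ^+ n.+1 - f ^+ n.+1 * s =
    (s * f - f * s) * f ^+ n + f * (s * f ^+ n - f ^+ n * s).
  by rewrite exprS mulrBl mulrBr !mulrA addrA subrK.
rewrite IH /= mulrS; congr (_ + _); first by apply: commr_sym; apply: commr_sym; apply: commrX.
case: n {IH} => [|n]; first by rewrite !mulr0n mulr0.
by rewrite mulrnAr mulrA -exprS.
Qed.

Section Commutation.
Variables (V : zmodType) (d p : nat) (G : group_system V d).
Hypotheses (p_pr : prime p) (d_lt_p : (d < p)%N) (Vp : forall x : V, x *+ p = 0).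
Variables S Lam A1 : set (endo V).
Hypothesis V_conn : conn G [set: V].
Hypothesis S_dend : forall s, S s -> dend G s.
Hypothesis S_minimal : forall H, dsub G H ->
  (forall s x, S s -> H x -> H (s x)) -> H = [set: V] \/ finite_index [set 0] H.
Hypothesis Lam_dend : forall l, Lam l -> dend G l.
Hypothesis Lam_comm : forall l l', Lam l -> Lam l' -> GRing.comm l l'.
Hypothesis Lam_normal : forall s l, S s -> Lam l -> Lam (s * l - l * s).
Hypothesis A1_Lam : A1 `<=` Lam.
Hypothesis A1_subgroup : additive_subgroup A1.
Hypothesis A1_neq0 : exists2 a, A1 a & a <> 0.
Hypothesis A1_conn : forall w : V, conn G [set a w | a in A1].
(** Definability is asked only of sets that are subgroups, as [dsub] demands; Frobenius will supply
    the subgroup property. *)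
Hypothesis A1_dsub : forall n (w : V),
  additive_subgroup [set (a ^+ (p ^ n)) w | a in A1] ->
  dsub G [set (a ^+ (p ^ n)) w | a in A1].

(* The definable part of the double centraliser of [Lam]: a commutative ring
   containing [Lam] and normalised by [S]. *)
Let centr (c : endo V) := forall l, Lam l -> GRing.comm c l.
Let AA : set (endo V) := [set f | dend G f /\ forall c, centr c -> GRing.comm c f].

Let endo_p (f : endo V) : f *+ p = 0.
Proof. by apply: endoP => x; rewrite endo_mulrnE. Qed.

Let Lam_AA l : Lam l -> AA l.
Proof. by move=> Ll; split; [exact: Lam_dend|move=> c /(_ _ Ll)]. Qed.

Let AA_comm f g : AA f -> AA g -> GRing.comm f g.
Proof.
move=> [_ cf] [_ cg]; apply: cg => l Ll; apply: commr_sym; apply: cf => l' Ll'.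
exact: Lam_comm.
Qed.

Let AA1 : AA 1.
Proof. by split; [exact: dend1|move=> c _; exact: commr1]. Qed.

Let AAB f g : AA f -> AA g -> AA (f - g).
Proof.
move=> [df cf] [dg cg]; split; first exact: dendB.
by move=> c cc; apply: commrB; [exact: cf|exact: cg].
Qed.

Let AAM f g : AA f -> AA g -> AA (f * g).
Proof.
move=> [df cf] [dg cg]; split; first exact: dendM.
by move=> c cc; apply: commrM; [exact: cf|exact: cg].
Qed.

Let AAX f n : AA f -> AA (f ^+ n).
Proof. by move=> Af; elim: n => [|n IH] //; rewrite exprS; exact: AAM. Qed.

Let AA_subgroup : additive_subgroup AA.
Proof. by split=> [|f g]; [rewrite -(subrr 1); exact: AAB|exact: AAB]. Qed.

(** By the Jacobi identity it suffices that [c * s - s * c] centralises [Lam] whenever [c] does,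
    which holds because [S] normalises [Lam]. *)
Let AA_commutator s f : S s -> AA f -> AA (s * f - f * s).
Proof.
move=> Ss [df cf]; have ds := S_dend Ss.
split; first by apply: dendB; exact: dendM.
move=> c cc; apply/commutator0; rewrite commutator_jacobi.
have /commutator0-> : GRing.comm c f by exact: cf.
rewrite mulr0 mul0r subr0 addr0; apply/commutator0; apply: cf => l Ll.
have /commutator0 := cc _ (Lam_normal Ss Ll).
rewrite commutator_jacobi; have /commutator0-> := cc _ Ll.
by rewrite mulr0 mul0r subr0 addr0 => /commutator0.
Qed.

Let S_exp_comm s f : S s -> AA f -> GRing.comm s (f ^+ p).
Proof.
move=> Ss Af; apply/commutator0; rewrite commutator_exp; first exact: endo_p.
exact: AA_comm (AA_commutator Ss Af).
Qed.

Let V_infinite : ~ finite_index [set 0] [set: V].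
Proof.
move=> /(conn_finite V_conn) V0; have [a _ a0] := A1_neq0; apply: a0; apply: endoP => x.
have : [set: V] (a x) by [].
by rewrite V0 => ->.
Qed.

Let one_neq0 : (1 : endo V) <> 0.
Proof.
move=> E; have [a _ a0] := A1_neq0; apply: a0.
by rewrite -[a]mulr1 E mulr0.
Qed.

Let surj (f : endo V) := forall y, exists x, f x = y.
Let finker (f : endo V) := finite_index [set 0] (f @^-1` [set 0]).

(** A form of Schur's lemma: image and kernel are [S]-invariant. The image is connected, so if
    finite it would be zero; a kernel equal to [V] would also make [g] zero. *)
Let central_dichotomy g : AA g -> (forall s, S s -> GRing.comm s g) ->
  g <> 0 -> surj g /\ finker g.
Proof.
move=> Ag Sg g0; have dg := Ag.1; split.
- have cim := conn_image dg V_conn.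
  have [s _ Ss [x _ <-]|imT y|] := S_minimal (conn_dsub cim).
  + by exists (s x) => //; rewrite -!endo_mulE Sg.
  + have : [set: V] y by [].
    by rewrite -imT => -[x _ <-]; exists x.
  + move=> /(conn_finite cim) im0; case: g0; apply: endoP => x.
    have : (g @` [set: V]) (g x) by exists x.
    by rewrite im0 => ->.
- have [s x Ss gx|kT|//] := S_minimal (dsub_preimage dg (dsub1 G)).
  + by rewrite /preimage /= -endo_mulE -Sg // endo_mulE gx endo0.
  + case: g0; apply: endoP => x.
    have : [set: V] x by [].
    by rewrite -kT.
Qed.

(** [f ^+ p] commutes with [S], and [f] has a larger image and a smaller kernel than [f ^+ p]. *)
Let dichotomy f : AA f -> f ^+ p <> 0 -> surj f /\ finker f.
Proof.
move=> Af fp; have [||sf kf] // := central_dichotomy (AAX p Af).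
  by move=> s Ss; exact: S_exp_comm.
have defp := prednK (prime_gt0 p_pr); split.
  move=> y; have [x <-] := sf y; exists ((f ^+ p.-1) x).
  by rewrite -endo_mulE -exprS defp.
apply: finite_index_sub kf _ => x fx.
by rewrite /preimage /= -defp exprSr endo_mulE fx endo0.
Qed.

(* The images of the powers of a nilpotent map form a strict chain of connected
   subgroups. *)
Let nilpotency_index f : AA f -> f ^+ p = 0 -> exists2 k, (k <= d)%N & f ^+ k = 0.
Proof.
move=> Af fp.
have cim k : conn G ((f ^+ k) @` [set: V]) by apply: conn_image V_conn; case: (AAX k Af).
have imS k : (f ^+ k.+1) @` [set: V] `<=` (f ^+ k) @` [set: V].
  by move=> _ [x _ <-]; exists (f x) => //; rewrite exprSr endo_mulE.
(* The images are listed in reverse so that they ascend. A step of finite index is an equality, so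
   the images are constant from [f ^+ k] on, and [f ^+ p = 0] forces [f ^+ k = 0]. *)
have [||n nd fi] := @dsub_ascending _ _ G (fun n => (f ^+ (d.+1 - n)) @` [set: V]).
- by move=> n _; exact: conn_dsub.
- by move=> n nd; rewrite subSS subSn //; exact: imS.
exists (d - n)%N; first exact: leq_subr.
move: fi; rewrite subSS subSn // => fi; have sub := conn_sub (cim _) (conn_dsub (cim _)) fi.
set k := (d - n)%N in sub *.
have step m : (f ^+ k) @` [set: V] `<=` (f ^+ (m + k)) @` [set: V].
  elim: m => [|m IH] // _ [x _ <-].
  have /sub[y _ <-] : ((f ^+ k) @` [set: V]) ((f ^+ k) x) by exists x.
  have /IH[z _ zE] : ((f ^+ k) @` [set: V]) ((f ^+ k) y) by exists y.
  by exists z => //; rewrite addSn exprS endo_mulE zE -endo_mulE -exprS.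
apply: endoP => x.
have /(step p)[y _ <-] : ((f ^+ k) @` [set: V]) ((f ^+ k) x) by exists x.
by rewrite exprD fp mul0r.
Qed.

(** Otherwise the commutator [b] is surjective. If [e.+1] is the nilpotency index of [f], the power
    rule gives [f ^+ e * b *+ e.+1 = 0]. As [e.+1 <= d < p], this yields [f ^+ e * b = 0], hence
    [f ^+ e = 0], against minimality. *)
Let nil_commutator s f : S s -> AA f -> f ^+ p = 0 -> (s * f - f * s) ^+ p = 0.
Proof.
move=> Ss Af fp; apply: contrapT => N.
have Ab := AA_commutator Ss Af; have [sb _] := dichotomy Ab N.
have [k0 k0d fk0] := nilpotency_index Af fp.
have ex : exists e, f ^+ e == 0 by exists k0; rewrite fk0.
case: (ex_minnP ex) => e /eqP fe emin.
have ed : (e <= d)%N by apply: leq_trans k0d; apply: emin; rewrite fk0.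
case: e fe emin ed => [|e] fe emin ed; first by apply: one_neq0; rewrite -fe.
have := commutator_exp e.+1 (AA_comm Af Ab); rewrite fe mulr0 mul0r subrr /=.
move=> /esym E; have ep : (e.+1 < p)%N by exact: leq_ltn_trans d_lt_p.
(* The factor [e.+1] is removed by a Bezout relation modulo [p]. *)
have {}E : f ^+ e * (s * f - f * s) = 0.
  have /eqnP cop : coprime e.+1 p by rewrite coprime_sym prime_coprime // gtnNdvd.
  case: (egcdnP p (ltn0Sn e)) => u v; rewrite cop => uv _.
  have := congr1 (GRing.natmul (f ^+ e * (s * f - f * s))) uv.
  by rewrite mulnC mulrnA E mul0rn mulrnDr [(v * _)%N]mulnC mulrnA endo_p mul0rn add0r.
have := emin e; rewrite ltnn => /(_ _)/notF; apply.
apply/eqP; apply: endoP => x; have [y <-] := sb x.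
by rewrite -endo_mulE E.
Qed.

Let no_nilpotent f : AA f -> f ^+ p = 0 -> f = 0.
Proof.
pose P (g : endo V) := AA g /\ g ^+ p = 0.
pose K := [set x : V | forall g, P g -> (g @^-1` [set 0]) x].
have dK : dsub G K.
  by apply: dsub_bigcap => g [[dg _] _]; apply: dsub_preimage => //; exact: dsub1.
have Kinf : ~ finite_index [set 0] K.
  (* Stability under [AA] is carried along so that each further nilpotent map still acts on the
     infinite group obtained so far. *)
  pose C A := [/\ dsub G A, ~ finite_index [set 0] A &
    forall g x, AA g -> A x -> A (g x)].
  suff [] : C K by [].
  apply: (@dsub_bigcap_ind _ _ G _ P (fun g => g @^-1` [set 0])).
  - by split; [exact: dsubT|exact: V_infinite|].
  - by move=> A [].
  move=> A g [dA infA invA] [Ag gp]; split.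
  - by apply: dsubI => //; apply: dsub_preimage; [exact: Ag.1|exact: dsub1].
  - move=> fin1.
    (* If [g] had finite kernel on [A], so would all its powers, including [g ^+ p = 0], and [A]
       would be finite. *)
    have fin n : finite_index [set 0] (A `&` ((g ^+ n) @^-1` [set 0])).
      elim: n => [|n IH].
        by exists [:: 0] => x [_ /= ->]; exists 0; rewrite ?inE ?subr0.
      apply: (@finite_kernel_image _ g).
      + apply: subgroupI; first exact: dsub_subgroup dA.
        by apply: subgroup_endo_preimage; exact: subgroup1.
      + by apply: finite_index_sub fin1 _ => x [[Ax _] gx].
      + apply: finite_index_sub IH _ => _ [x [Ax gx] <-]; split; first exact: invA.
        by rewrite /preimage /= -endo_mulE -exprSr.
    by apply: infA; apply: finite_index_sub (fin p) _ => x Ax; split=> //; rewrite gp.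
  - move=> h x Ah [Ax gx]; split; first exact: invA.
    by rewrite /preimage /= -endo_mulE (AA_comm Ag Ah) endo_mulE gx endo0.
have [s x Ss Kx g [Ag gp]|KT|//] := S_minimal dK; last first.
  move=> Af fp; apply: endoP => x.
  have Kx : K x by rewrite KT.
  by apply: Kx.
(* The commutator is again nilpotent, so it kills [x]; since [g] kills [x] too, [g] kills [s x]. *)
have e0 : (s * g - g * s) x = 0.
  by apply: Kx; split; [exact: AA_commutator|exact: nil_commutator].
rewrite endo_subE !endo_mulE in e0.
have gx : g x = 0 by apply: Kx.
rewrite /preimage /=.
by move: e0; rewrite gx endo0 sub0r => /eqP; rewrite oppr_eq0 => /eqP.
Qed.

Let AA_reduced f n : AA f -> f ^+ (p ^ n) = 0 -> f = 0.
Proof.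
move=> Af; elim: n => [|n IH]; first by rewrite expr1.
by rewrite expnSr exprM => H; apply: IH; apply: no_nilpotent H; exact: AAX.
Qed.

Let AA_regular f : AA f -> f <> 0 -> surj f /\ finker f.
Proof. by move=> Af f0; apply: dichotomy => // /(no_nilpotent Af). Qed.

Theorem commutation s l : S s -> Lam l -> GRing.comm s l.
Proof.
have [a0 Aa0 a0n] := A1_neq0.
have A1_AA a : A1 a -> AA a by move=> /A1_Lam /Lam_AA.
have [w a0w] : exists w, a0 w <> 0.
  by apply: contrapT => N; apply: a0n; apply: endoP => x; apply: contrapT => M; apply: N; exists x.
(* Evaluation at [w] is injective on [AA]: a nonzero [f] killing [w] would, by commutativity, have
   the connected group of all [a w] in its finite kernel, forcing [a0 w = 0]. *)
have inj f : AA f -> f w = 0 -> f = 0.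
  move=> Af fw; apply: contrapT => f0; have [_ kf] := AA_regular Af f0.
  apply: a0w; suff E : [set a w | a in A1] = [set 0].
    have : [set a w | a in A1] (a0 w) by exists a0.
    by rewrite E.
  apply: conn_finite => //; apply: finite_index_sub kf _ => _ [a Aa <-].
  by rewrite /preimage /= -endo_mulE (AA_comm Af (A1_AA _ Aa)) endo_mulE fw endo0.
have frob n f g : AA f -> AA g -> (f - g) ^+ (p ^ n) = f ^+ (p ^ n) - g ^+ (p ^ n).
  by move=> Af Ag; apply: exprB_pchar_iter_comm => //; exact: AA_comm.
(* Through evaluation at [w], [U] encodes the elements [g] of [AA] with [g w] in [U], and [Upow U n]
   encodes their [p ^ n]-th powers. *)
pose Upow (U : set V) n := [set (g ^+ (p ^ n)) w | g in [set g | AA g /\ U (g w)]].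
(* The second clause bounds [U] by the group generated by all [al (a w)]. Together with the
   absorption of every [al (A1 w)], it makes the final [U] the image of the ideal generated by
   [A1]. *)
pose C (U : set V) := [/\ conn G U,
  forall K, additive_subgroup K ->
    (forall al a, AA al -> A1 a -> K (al (a w))) -> U `<=` K &
  forall n, dsub G (Upow U n)].
have [||||U [cU Usub dU] FU] := @conn_sum_ind _ _ G _ AA
    (fun al => al @` [set a w | a in A1]) C.
- split; first exact: conn0.
    by move=> K sK _ _ ->; exact: subgroup0.
  move=> n; suff -> : Upow [set 0] n = [set 0] by exact: dsub1.
  apply/seteqP; split=> [_ [g [Ag gw] <-]|_ ->].
    by rewrite (inj _ Ag gw) expr0n expn_eq0 -leqn0 leqNgt prime_gt0.
  exists 0; first by split=> //; exact: AA_subgroup.1.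
  by rewrite expr0n expn_eq0 -leqn0 leqNgt prime_gt0.
- by move=> A [].
- by move=> al _; apply: subgroup_endo_image; exact: conn_subgroup (A1_conn w).
- move=> U al [cU Usub dU] Aal; split.
  + by apply: conn_sum => //; apply: conn_image => //; exact: Aal.1.
  + move=> K sK HK; apply: sum_set_sub => //; first exact: Usub.
    by move=> _ [_ [a Aa <-] <-]; exact: HK.
  + move=> n; have -> : Upow (sum_set U (al @` [set a w | a in A1])) n =
        sum_set (Upow U n) ((al ^+ (p ^ n)) @` [set (a ^+ (p ^ n)) w | a in A1]).
      (* Frobenius is additive on [AA]: subtracting [al * a] splits the power of [g] into a part
         coming from [U] and a part coming from the new summand. *)
      have E g a : AA g -> A1 a ->
          (g ^+ (p ^ n)) w = ((g - al * a) ^+ (p ^ n)) w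
            + (al ^+ (p ^ n)) ((a ^+ (p ^ n)) w).
        move=> Ag Aa; have Aa' := A1_AA _ Aa; rewrite frob //; last exact: AAM.
        rewrite endo_subE -endo_mulE -exprMn_comm ?subrK //; exact: AA_comm.
      apply/seteqP; split.
        move=> _ [g [Ag [u Uu [_ [_ [a Aa <-] <-] gw]]] <-].
        rewrite (E _ _ Ag Aa).
        exists (((g - al * a) ^+ (p ^ n)) w).
          exists (g - al * a) => //; split; first by apply: AAB => //; apply: AAM => //; exact: A1_AA.
          by rewrite endo_subE endo_mulE -gw addrK.
        exists ((al ^+ (p ^ n)) ((a ^+ (p ^ n)) w)) => //.
        by exists ((a ^+ (p ^ n)) w) => //; exists a.
      move=> _ [_ [g [Ag Ug] <-] [_ [_ [a Aa <-] <-] <-]].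
      have AA' : AA (g + al * a).
        rewrite -[al * a]opprK; apply: AAB => //; rewrite -sub0r.
        by apply: AAB; [exact: AA_subgroup.1|apply: AAM => //; exact: A1_AA].
      exists (g + al * a).
        split=> //; exists (g w) => //; exists (al (a w)) => //.
        by exists (a w) => //; exists a.
      by rewrite (E _ _ AA' Aa) addrK.
    apply: dsub_sum => //; apply: dsub_image; first by case: (AAX (p ^ n) Aal).
    apply: A1_dsub; split.
      exists 0; first exact: subgroup0.
      by rewrite expr0n expn_eq0 -leqn0 leqNgt prime_gt0.
    move=> _ _ [a Aa <-] [b Ab <-]; exists (a - b); first exact: subgroupB.
    by rewrite frob //; exact: A1_AA.
(* [g ^+ p.-1] maps the generators [al (a w)] of [U] into [U], hence also [g w]. So the sets
   [Upow U n] descend. *)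
have JX g : AA g -> U (g w) -> U ((g ^+ p) w).
  move=> Ag Ug; pose K := (g ^+ p.-1) @^-1` U.
  have UK : U `<=` K.
    apply: Usub; first by apply: subgroup_endo_preimage; exact: conn_subgroup cU.
    move=> al a Aal Aa; apply: (FU (g ^+ p.-1 * al)); first by apply: AAM => //; exact: AAX.
    by exists (a w) => //; exists a.
  by rewrite -(prednK (prime_gt0 p_pr)) exprSr endo_mulE; exact: UK.
have [|n En] := dsub_descending dU.
  move=> n _ [g [Ag Ug] <-]; exists (g ^+ p); first by split; [exact: AAX|exact: JX].
  by rewrite -exprM -expnS.
(* Where the chain stabilises, [g ^+ (p ^ n)] is the [p ^ n]-th power of some [h ^+ p]. Since [AA]
   is reduced, [g = h ^+ p], and [p]-th powers commute with [S]. *)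
have J_comm g t : AA g -> U (g w) -> S t -> GRing.comm t g.
  move=> Ag Ug St.
  have : Upow U n ((g ^+ (p ^ n)) w) by exists g.
  rewrite -En => -[h [Ah _] hE].
  suff -> : g = h ^+ p by exact: S_exp_comm.
  apply/eqP; rewrite -subr_eq0; apply/eqP; apply: (@AA_reduced _ n).
    by apply: AAB => //; exact: AAX.
  have Ahp := AAX p Ah.
  apply: inj; first by apply: AAX; exact: AAB.
  by rewrite frob // endo_subE -hE -exprM -expnS subrr.
(* Both [a0] and [l * a0] lie in the ideal and commute with [s], so [s * l - l * s] kills the image
   of [a0], which is everything. *)
move=> Ss Ll; have Al := Lam_AA Ll; have Aa0' := A1_AA _ Aa0.
have Ua f : AA f -> U ((f * a0) w).
  by move=> Af; apply: (FU f) => //; exists (a0 w) => //; exists a0.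
have /= c1 := J_comm (l * a0) s (AAM Al Aa0') (Ua _ Al) Ss.
have := J_comm (1 * a0) s (AAM AA1 Aa0') (Ua _ AA1) Ss; rewrite mul1r => c2.
apply/commutator0; apply: endoP => y; have [x <-] := (AA_regular Aa0' a0n).1 y.
by rewrite -endo_mulE mulrBl -!mulrA c1 c2 mulrA subrr.
Qed.

End Commutation.

(** * Definable sections *)

Record subquotient (V : zmodType) := Subquotient {
  sq_top : set V;
  sq_bot : set V;
  sq_top_subgroup : additive_subgroup sq_top;
  sq_bot_subgroup : additive_subgroup sq_bot;
  sq_bot_top : sq_bot `<=` sq_top }.

(* The quotient [sq_top X / sq_bot X], realised by chosen representatives. *)
Section SectionQuotient.
Variables (V : zmodType) (X : subquotient V).
Let W := sq_top X.
Let B := sq_bot X.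
Let sW : additive_subgroup W := sq_top_subgroup X.
Let sB : additive_subgroup B := sq_bot_subgroup X.
Let BW : B `<=` W := @sq_bot_top V X.

Let same (x : V) : pred V := fun y => `[< B (x - y) >].

Definition coset_repr (x : V) : V := choose (same x) x.

Lemma coset_reprP x : B (x - coset_repr x).
Proof.
by apply/asboolP/(@chooseP _ (same x)); apply/asboolP; rewrite subrr; exact: subgroup0.
Qed.

(** [choose] depends on its predicate only up to extensional equality, and not on which element
    witnesses it. *)
Lemma coset_repr_eq x y : B (x - y) -> coset_repr x = coset_repr y.
Proof.
move=> Bxy; have E : same x =1 same y.
  move=> z; apply/asboolP/asboolP => H.
    have -> : y - z = (x - z) - (x - y) by rewrite opprB [RHS]addrC addrA subrK.
    exact: subgroupB.
  by have -> : x - z = (x - y) + (y - z); [rewrite addrA subrK|exact: subgroupD].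
rewrite /coset_repr -(eq_choose E); apply: choose_id.
  by apply/asboolP; rewrite subrr; exact: subgroup0.
exact/asboolP.
Qed.

Definition canonical_repr : pred V := fun x => `[< W x /\ coset_repr x = x >].

Definition quot : Type := {x : V | canonical_repr x}.

HB.instance Definition _ := SubChoice.on quot.

Lemma quot_val_top (u : quot) : W (val u).
Proof. by have /asboolP[] := valP u. Qed.

(** Elements outside [W] are sent to the class of [0], which makes [to_quot] total. *)
Fact quot_mk_subproof x :
  canonical_repr (coset_repr (if `[< W x >] then x else 0)).
Proof.
set z := if _ then _ else _.
have Wz : W z by rewrite /z; case: asboolP => // _; exact: subgroup0.
apply/asboolP => /=; split.
  have -> : coset_repr z = z - (z - coset_repr z) by rewrite opprB addrC subrK.
  by apply: subgroupB => //; apply: BW; exact: coset_reprP.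
apply: coset_repr_eq; rewrite -opprB; apply: subgroupN => //; exact: coset_reprP.
Qed.

Definition to_quot (x : V) : quot := exist canonical_repr _ (quot_mk_subproof x).

Lemma val_to_quot x : W x -> val (to_quot x) = coset_repr x.
Proof. by move=> /asboolP Wx; rewrite /= Wx. Qed.

Lemma to_quot_eq x y : W x -> W y -> to_quot x = to_quot y <-> B (x - y).
Proof.
move=> Wx Wy; split=> [E|Bxy].
  have {}E : coset_repr x = coset_repr y by rewrite -!val_to_quot // E.
  have -> : x - y = (x - coset_repr x) - (y - coset_repr y).
    by rewrite E opprB addrA subrK.
  by apply: subgroupB => //; exact: coset_reprP.
by apply: val_inj; rewrite !val_to_quot //; exact: coset_repr_eq.
Qed.

Lemma val_quotK u : to_quot (val u) = u.
Proof.
apply: val_inj; rewrite val_to_quot; last exact: quot_val_top.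
by have /asboolP[] := valP u.
Qed.

Lemma to_quot_surj u : exists2 x, W x & u = to_quot x.
Proof. by exists (val u); [exact: quot_val_top|rewrite val_quotK]. Qed.

Let repr_diff x : W x -> B (x - val (to_quot x)).
Proof. by move=> Wx; rewrite val_to_quot //; exact: coset_reprP. Qed.

Definition quot_add (u v : quot) : quot := to_quot (val u + val v).
Definition quot_opp (u : quot) : quot := to_quot (- val u).

Let addE x y : W x -> W y -> quot_add (to_quot x) (to_quot y) = to_quot (x + y).
Proof.
move=> Wx Wy; apply/to_quot_eq.
- by apply: subgroupD => //; exact: quot_val_top.
- exact: subgroupD.
rewrite -opprB; apply: subgroupN => //; rewrite opprD addrACA.
by apply: subgroupD => //; exact: repr_diff.
Qed.

Let oppE x : W x -> quot_opp (to_quot x) = to_quot (- x).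
Proof.
move=> Wx; apply/to_quot_eq.
- by apply: subgroupN => //; exact: quot_val_top.
- exact: subgroupN.
by rewrite opprK addrC; exact: repr_diff.
Qed.

Fact quot_addA : associative quot_add.
Proof.
move=> u v w; have [x Wx ->] := to_quot_surj u; have [y Wy ->] := to_quot_surj v.
have [z Wz ->] := to_quot_surj w.
by rewrite !addE ?addrA //; exact: subgroupD.
Qed.

Fact quot_addC : commutative quot_add.
Proof. by move=> u v; rewrite /quot_add addrC. Qed.

Fact quot_add0 : left_id (to_quot 0) quot_add.
Proof.
move=> u; have [x Wx ->] := to_quot_surj u.
by rewrite addE ?add0r //; exact: subgroup0.
Qed.

Fact quot_addN : left_inverse (to_quot 0) quot_opp quot_add.
Proof.
move=> u; have [x Wx ->] := to_quot_surj u.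
by rewrite oppE // addE ?addNr //; exact: subgroupN.
Qed.

HB.instance Definition _ :=
  GRing.isZmodule.Build quot quot_addA quot_addC quot_add0 quot_addN.

Lemma to_quot0 : to_quot 0 = 0.
Proof. by []. Qed.

Lemma to_quotD x y : W x -> W y -> to_quot (x + y) = to_quot x + to_quot y.
Proof. by move=> Wx Wy; rewrite -addE. Qed.

Lemma to_quotN x : W x -> to_quot (- x) = - to_quot x.
Proof. by move=> Wx; rewrite -oppE. Qed.

Lemma to_quotB x y : W x -> W y -> to_quot (x - y) = to_quot x - to_quot y.
Proof. by move=> Wx Wy; rewrite to_quotD ?to_quotN //; exact: subgroupN. Qed.

Lemma to_quot_eq0 x : W x -> to_quot x = 0 <-> B x.
Proof.
by move=> Wx; rewrite -to_quot0 to_quot_eq ?subr0 //; exact: subgroup0.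
Qed.

Lemma quot_exponent n : (forall x : V, x *+ n = 0) -> forall u : quot, u *+ n = 0.
Proof.
move=> V0 u; have [x Wx ->] := to_quot_surj u.
suff E m : W (x *+ m) /\ to_quot (x *+ m) = to_quot x *+ m by rewrite -(E n).2 V0.
elim: m => [|m [Wm Em]]; first by split=> //; exact: subgroup0.
by rewrite !mulrS to_quotD // Em; split=> //; exact: subgroupD.
Qed.

Definition stable (f : V -> V) : Prop :=
  (forall x, W x -> W (f x)) /\ (forall x, B x -> B (f x)).

Definition induces (f : V -> V) (g : quot -> quot) : Prop :=
  forall x, W x -> g (to_quot x) = to_quot (f x).

Fact quot_endo_subproof (f : endo V) : stable f ->
  forall u v : quot, to_quot (f (val (u - v))) = to_quot (f (val u)) - to_quot (f (val v)).
Proof.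
move=> [fW fB] u v; have Wu := quot_val_top u; have Wv := quot_val_top v.
rewrite -to_quotB; [|exact: fW..].
rewrite -endoB; apply/to_quot_eq; [apply: fW; exact: quot_val_top|by apply: fW; exact: subgroupB|].
rewrite -endoB; apply: fB; apply/to_quot_eq; [exact: quot_val_top|exact: subgroupB|].
by rewrite val_quotK to_quotB // !val_quotK.
Qed.

Definition quot_endo (f : endo V) (fS : stable f) : endo quot :=
  Endo (quot_endo_subproof fS).

Lemma induces_quot_endo (f : endo V) (fS : stable f) : induces f (quot_endo fS).
Proof.
move=> x Wx; have [fW fB] := fS.
change (to_quot (f (val (to_quot x))) = to_quot (f x)).
apply/to_quot_eq; [apply: fW; exact: quot_val_top|exact: fW|].
by rewrite -endoB; apply: fB; rewrite -opprB; apply: subgroupN => //; exact: repr_diff.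
Qed.

Lemma induces_inj f (g h : endo quot) : induces f g -> induces f h -> g = h.
Proof.
by move=> fg fh; apply: endoP => u; have [x Wx ->] := to_quot_surj u; rewrite fg // fh.
Qed.

(** Subgroups of the quotient correspond to subgroups between [B] and [W]; definability and index
    are compared there. *)
Definition pullback (H : set quot) : set V := [set x | W x /\ H (to_quot x)].

Lemma pullback_sub (H K : set quot) : pullback H `<=` pullback K -> H `<=` K.
Proof. by move=> HK u; have [x Wx ->] := to_quot_surj u => Hx; have [] := HK x (conj Wx Hx). Qed.

Lemma subgroup_pullback H : additive_subgroup H -> additive_subgroup (pullback H).
Proof.
move=> sH; split; first by split; rewrite ?to_quot0; exact: subgroup0.
move=> x y [Wx Hx] [Wy Hy]; split; first exact: subgroupB.
by rewrite to_quotB //; exact: subgroupB.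
Qed.

Lemma pullback_subgroup H : additive_subgroup (pullback H) -> additive_subgroup H.
Proof.
move=> sH; split; first by have [] := subgroup0 sH.
move=> u v; have [x Wx ->] := to_quot_surj u; have [y Wy ->] := to_quot_surj v => Hx Hy.
by rewrite -to_quotB //; have [] := @subgroupB _ _ x y sH (conj Wx Hx) (conj Wy Hy).
Qed.

Lemma sub_bot_pullback H : additive_subgroup H -> B `<=` pullback H.
Proof.
move=> sH x Bx; split; first exact: BW.
by have /to_quot_eq0-> := Bx; [exact: subgroup0|exact: BW].
Qed.

Lemma finite_index_pullback H K :
  finite_index H K -> finite_index (pullback H) (pullback K).
Proof.
move=> [s Hs]; exists (map val s) => x [Wx Kx]; have [u us Hu] := Hs _ Kx.
exists (val u); first exact: map_f.
have Wu := quot_val_top u; split; first exact: subgroupB.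
by rewrite to_quotB // val_quotK.
Qed.

Lemma pullback_finite_index H K :
  finite_index (pullback H) (pullback K) -> finite_index H K.
Proof.
move=> [s Hs]; exists (map to_quot s) => u; have [x Wx ->] := to_quot_surj u => Kx.
have [y ys [Wxy Hxy]] := Hs x (conj Wx Kx); exists (to_quot y); first exact: map_f.
rewrite -to_quotB //; have -> : y = x - (x - y) by rewrite opprB addrC subrK.
exact: subgroupB.
Qed.

Lemma pullbackT : pullback setT = W.
Proof. by apply/seteqP; split=> [x []|x]. Qed.

Lemma pullback1 : pullback [set 0] = B.
Proof.
apply/seteqP; split=> [x [Wx /to_quot_eq0]|x Bx]; first exact.
by split; [exact: BW|apply/to_quot_eq0 => //; exact: BW].
Qed.

Lemma pullback_image f g (H : set quot) : stable f -> induces f g ->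
  (forall x y, f (x + y) = f x + f y) ->
  pullback (g @` H) = sum_set (f @` (pullback H)) B.
Proof.
move=> [fW fB] fg fD; apply/seteqP; split.
  move=> y [Wy [u]]; have [x Wx ->] := to_quot_surj u => Hx; rewrite fg // => E.
  exists (f x); first by exists x.
  exists (y - f x); last by rewrite addrC subrK.
  by apply/to_quot_eq => //; exact: fW.
move=> _ [_ [x [Wx Hx] <-] [b Bb <-]]; have Wfx := fW _ Wx; split.
  by apply: subgroupD => //; exact: BW.
exists (to_quot x) => //; rewrite fg // to_quotD //; last exact: BW.
by have /to_quot_eq0-> := Bb; [rewrite addr0|exact: BW].
Qed.

End SectionQuotient.

(** * The chain conditions pass to definable sections *)

Section SectionSystem.
Variables (V : zmodType) (d : nat) (G : group_system V d) (X : subquotient V).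
Let W := sq_top X.
Let B := sq_bot X.
Let sW : additive_subgroup W := sq_top_subgroup X.
Let sB : additive_subgroup B := sq_bot_subgroup X.
Let BW : B `<=` W := @sq_bot_top V X.
Hypotheses (dW : dsub G W) (dB : dsub G B).

(** The quotient carries no chart: a subset counts as definable when its pullback is, and an
    endomorphism when a definable stable endomorphism of [V] induces it. *)
Definition quot_dsub (H : set (quot X)) : Prop := dsub G (pullback H).
Definition quot_dend (g : endo (quot X)) : Prop :=
  exists f : endo V, [/\ dend G f, stable X f & induces f g].

Fact quot_dsub_subgroup H : quot_dsub H -> additive_subgroup H.
Proof. by move=> dH; apply: pullback_subgroup; exact: dsub_subgroup dH. Qed.

Fact quot_dsubT : quot_dsub setT.
Proof. by rewrite /quot_dsub pullbackT. Qed.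

Fact quot_dsub1 : quot_dsub [set 0].
Proof. by rewrite /quot_dsub pullback1. Qed.

Fact quot_dsubI H K : quot_dsub H -> quot_dsub K -> quot_dsub (H `&` K).
Proof.
move=> dH dK; rewrite /quot_dsub.
have -> : pullback (H `&` K) = pullback H `&` pullback K; last exact: dsubI.
by apply/seteqP; split=> [x [Wx []]|x [[Wx Hx] []]].
Qed.

Fact quot_dsub_sum H K : quot_dsub H -> quot_dsub K -> quot_dsub (sum_set H K).
Proof.
move=> dH dK; rewrite /quot_dsub.
have -> : pullback (sum_set H K) = sum_set (pullback H) (pullback K); last exact: dsub_sum.
have sH := quot_dsub_subgroup dH; apply/seteqP; split.
  move=> x [Wx [u Hu [v Kv uv]]]; have [y Wy Ey] := to_quot_surj v.
  have Wxy : W (x - y) by exact: subgroupB.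
  exists (x - y); last by exists y; [split=> //; rewrite -Ey|rewrite subrK].
  by split=> //; rewrite to_quotB // -uv Ey addrK.
move=> _ [x [Wx Hx] [y [Wy Ky] <-]]; split; first exact: subgroupD.
by rewrite to_quotD //; exists (to_quot X x) => //; exists (to_quot X y).
Qed.

Fact quot_dsub_image g H : quot_dend g -> quot_dsub H -> quot_dsub (g @` H).
Proof.
move=> [f [df sf fg]] dH; rewrite /quot_dsub (pullback_image H sf fg); last exact: endoD.
by apply: dsub_sum => //; exact: dsub_image.
Qed.

Fact quot_dsub_preimage g H : quot_dend g -> quot_dsub H -> quot_dsub (g @^-1` H).
Proof.
move=> [f [df [fW fB] fg]] dH; rewrite /quot_dsub.
have -> : pullback (g @^-1` H) = W `&` f @^-1` (pullback H).
  apply/seteqP; split=> x [Wx]; rewrite /preimage /=.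
    by rewrite fg // => Hx; split=> //; split=> //; exact: fW.
  by move=> [Wfx Hx]; split=> //=; rewrite fg.
by apply: dsubI => //; exact: dsub_preimage.
Qed.

Fact quot_dend1 : quot_dend 1.
Proof. by exists 1; split=> //; exact: dend1. Qed.

Fact quot_dendB g h : quot_dend g -> quot_dend h -> quot_dend (g - h).
Proof.
move=> [f [df [fW fB] fg]] [f' [df' [fW' fB'] fg']]; exists (f - f'); split.
- exact: dendB.
- by split=> x Wx; rewrite endo_subE; apply: subgroupB => //; auto.
- move=> x Wx; rewrite !endo_subE fg // fg' // to_quotB //; [exact: fW|exact: fW'].
Qed.

Fact quot_dendM g h : quot_dend g -> quot_dend h -> quot_dend (g * h).
Proof.
move=> [f [df [fW fB] fg]] [f' [df' [fW' fB'] fg']]; exists (f * f'); split.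
- exact: dendM.
- by split=> x Wx; rewrite endo_mulE; auto.
- by move=> x Wx; rewrite !endo_mulE fg' // fg //; exact: fW'.
Qed.

Fact quot_dsub_descending (A : nat -> set (quot X)) : (forall n, quot_dsub (A n)) ->
  (forall n, A n.+1 `<=` A n) -> exists n, A n.+1 = A n.
Proof.
move=> dA AS; have [|n E] := dsub_descending dA.
  by move=> n x [Wx Ax]; split=> //; exact: AS.
by exists n; apply/seteqP; split; apply: pullback_sub; rewrite E.
Qed.

Fact quot_dsub_ascending (A : nat -> set (quot X)) :
  (forall n, (n <= d.+1)%N -> quot_dsub (A n)) ->
  (forall n, (n <= d)%N -> A n `<=` A n.+1) ->
  exists2 n, (n <= d)%N & finite_index (A n) (A n.+1).
Proof.
move=> dA AS; have [|n nd fi] := dsub_ascending dA.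
  by move=> n nd x [Wx Ax]; split=> //; exact: AS.
by exists n => //; exact: pullback_finite_index.
Qed.

Definition quot_system : group_system (quot X) d :=
  GroupSystem quot_dsub_subgroup quot_dsubT quot_dsub1 quot_dsubI quot_dsub_sum
    quot_dsub_image quot_dsub_preimage quot_dend1 quot_dendB quot_dendM
    quot_dsub_descending quot_dsub_ascending.

Lemma conn_pullback H : conn G (pullback H) -> conn quot_system H.
Proof.
move=> [dH cH]; split=> // K dK KH fK; apply/seteqP; split=> //.
apply: pullback_sub; rewrite (cH (pullback K)) //.
  by move=> x [Wx Kx]; split=> //; exact: KH.
exact: finite_index_pullback.
Qed.

End SectionSystem.

(** * Lie rings *)

Section LieIdentities.
Variable r : lieRingType.
Implicit Types (x y z : r) (A B I : set r).

Lemma lieBr x y z : lie x (y - z) = lie x y - lie x z.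
Proof. by apply/eqP; rewrite eq_sym subr_eq -lieDr subrK. Qed.

Lemma lieBl x y z : lie (x - y) z = lie x z - lie y z.
Proof. by apply/eqP; rewrite eq_sym subr_eq -lieDl subrK. Qed.

Lemma lieC x y : lie x y = - lie y x.
Proof.
have := liexx (x + y); rewrite lieDl !lieDr !liexx add0r addr0 => /eqP.
by rewrite addr_eq0 => /eqP.
Qed.

Lemma lie0r x : lie x 0 = 0.
Proof. by have := lieBr x 0 0; rewrite !subrr. Qed.

Lemma lieNr x y : lie x (- y) = - lie x y.
Proof. by rewrite -sub0r lieBr lie0r sub0r. Qed.

Lemma lieNl x y : lie (- x) y = - lie x y.
Proof. by rewrite lieC lieNr opprK -lieC. Qed.

Lemma lie0l y : lie 0 y = 0.
Proof. by rewrite lieC lie0r oppr0. Qed.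

Lemma lie_leibniz x y z : lie x (lie y z) = lie (lie x y) z + lie y (lie x z).
Proof.
have /eqP := lie_jacobi x y z.
rewrite -addrA addr_eq0 => /eqP ->.
by rewrite opprD -(lieC (lie x y) z) -lieNr -(lieC x z) addrC.
Qed.

Definition ad x : endo r := Endo (lieBr x).
(** The bracket as a function of the acting element: conditions [B (lie a w)] on [a] become
    preimages under an endomorphism. *)
Definition rad y : endo r := Endo (fun x z => lieBl x z y).

Lemma lie_spanP A B x y : A x -> B y -> lie_span A B (lie x y).
Proof. by move=> Ax By; apply: sub_gen_smallest; exists x => //; exists y. Qed.

Lemma lie_span_sub A B I : additive_subgroup I ->
  (forall x y, A x -> B y -> I (lie x y)) -> lie_span A B `<=` I.
Proof. by move=> sI H; apply: smallest_sub => // _ [x Ax [y By <-]]; exact: H. Qed.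

Lemma subgroup_lie_span A B : additive_subgroup (lie_span A B).
Proof.
split; first by move=> I [sI _]; exact: subgroup0.
move=> x y Hx Hy I [sI HI]; apply: subgroupB => //; [exact: Hx|exact: Hy].
Qed.

Lemma lie_ideal_span I J : lie_ideal I -> lie_ideal J -> lie_ideal (lie_span I J).
Proof.
move=> [_ iI] [_ iJ]; split; first exact: subgroup_lie_span.
have sS := @subgroup_lie_span I J.
move=> x y; apply: (@lie_span_sub _ _ (ad x @^-1` lie_span I J)).
  exact: subgroup_endo_preimage.
move=> a b Ia Jb; rewrite /preimage /= lie_leibniz.
by apply: (subgroupD sS); apply: lie_spanP => //; [exact: iI|exact: iJ].
Qed.

(** The first bracket only brings [x] into [I], whence the shift by one. So elements of a nilpotent
    ideal are ad-nilpotent. *)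
Lemma iter_lie_lower_central I a n : lie_ideal I -> I a ->
  forall x, lower_central_series I n (iter n.+1 (lie a) x).
Proof.
move=> [sI iI] Ia; elim: n => [|n IH] x.
  by rewrite /= lieC; apply: subgroupN => //; exact: iI.
by rewrite iterS /=; apply: lie_spanP => //; exact: IH.
Qed.

End LieIdentities.

(** * Definable Lie rings of bounded rank and the action on their sections *)

Section LieSystem.
Variables (L : language) (M : structure L) (r : lieRingType).
Variables (D : lie_definable_in M r) (m0 : M) (d : nat).
Hypothesis rank_bound : ~ rank_at_least D d.+1 [set: r].

Definition lie_dsub (A : set r) : Prop := definable_set D A /\ additive_subgroup A.
Definition lie_dend (f : endo r) : Prop := rdfun D f.

Fact lie_dsubI A B : lie_dsub A -> lie_dsub B -> lie_dsub (A `&` B).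
Proof. by move=> [dA sA] [dB sB]; split; [exact: definable_setI|exact: subgroupI]. Qed.

Fact lie_dsub_sum A B : lie_dsub A -> lie_dsub B -> lie_dsub (sum_set A B).
Proof. by move=> [dA sA] [dB sB]; split; [exact: definable_set_sum|exact: subgroup_sum]. Qed.

Fact lie_dsub_image f A : lie_dend f -> lie_dsub A -> lie_dsub (f @` A).
Proof.
by move=> df [dA sA]; split; [exact: definable_set_image|exact: subgroup_endo_image].
Qed.

Fact lie_dsub_preimage f A : lie_dend f -> lie_dsub A -> lie_dsub (f @^-1` A).
Proof.
by move=> df [dA sA]; split; [exact: definable_set_preimage|exact: subgroup_endo_preimage].
Qed.

Fact lie_dendB f g : lie_dend f -> lie_dend g -> lie_dend (f - g).
Proof. exact: rdfun_sub. Qed.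

Fact lie_dendM f g : lie_dend f -> lie_dend g -> lie_dend (f * g).
Proof. exact: rdfun_comp. Qed.

Fact lie_descending (A : nat -> set r) : (forall n, lie_dsub (A n)) ->
  (forall n, A n.+1 `<=` A n) -> exists n, A n.+1 = A n.
Proof.
move=> dA AS; apply: contrapT => N; apply: rank_bound.
apply: (@rank_at_least_sub _ _ _ _ _ (A 0%N)) => //.
apply: (rank_descending m0 _ _ (fun n => (dA n).1) (fun n => (dA n).2) AS) => n E.
by apply: N; exists n.
Qed.

Fact lie_ascending (A : nat -> set r) :
  (forall n, (n <= d.+1)%N -> lie_dsub (A n)) ->
  (forall n, (n <= d)%N -> A n `<=` A n.+1) ->
  exists2 n, (n <= d)%N & finite_index (A n) (A n.+1).
Proof.
move=> dA AS; apply: contrapT => N; apply: rank_bound.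
apply: (@rank_at_least_sub _ _ _ _ _ (A d.+1)) => //.
apply: (rank_ascending m0 dA) => i id; split; first exact: AS.
by move=> fi; apply: N; exists i.
Qed.

Definition lie_system : group_system r d :=
  @GroupSystem r d lie_dsub lie_dend (fun A dA => dA.2)
    (conj (definable_setT D) (subgroupT r))
    (conj (definable_set1 D m0 0) (@subgroup1 r))
    lie_dsubI lie_dsub_sum lie_dsub_image lie_dsub_preimage
    (rdfun_id D m0) lie_dendB lie_dendM lie_descending lie_ascending.

Let G := lie_system.

Lemma connP A : definable_set D A -> additive_subgroup A ->
  connected D A <-> conn G A.
Proof.
move=> dA sA; split=> [cA|[_ cA]].
  by split=> // H [dH sH]; exact: cA.
by move=> H dH sH; exact: cA.
Qed.

Lemma dend_ad x : dend G (ad x).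
Proof. exact: (rdfun_lie m0 (rdfun_cst D m0 x) (rdfun_id D m0)). Qed.

Lemma dend_rad x : dend G (rad x).
Proof. exact: (rdfun_lie m0 (rdfun_id D m0) (rdfun_cst D m0 x)). Qed.

Lemma rdfun_iter_lie n w : rdfun D (fun a => iter n (lie a) w).
Proof.
elim: n => [|n IH]; first exact: rdfun_cst.
exact: (rdfun_lie m0 (rdfun_id D m0) IH).
Qed.

Variable p : nat.
Hypotheses (p_pr : prime p) (d_lt_p : (d < p)%N) (r_p : forall x : r, x *+ p = 0).
Hypothesis r_conn : conn G [set: r].
Hypothesis r_soluble : soluble [set: r].

Definition invariant (Sig H : set r) : Prop :=
  forall s x, Sig s -> H x -> H (lie s x).

(** The commutation theorem for the operators [ad s] on [W / B]: by the Leibniz rule their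
    commutators are induced by brackets, so commuting there means that the bracket sends [W] into
    [B]. *)
Lemma lie_commutation (W B Sig Lam A : set r) :
  conn G W -> conn G B -> B `<=` W -> invariant Sig W -> invariant Sig B ->
  (forall H, conn G H -> invariant Sig H -> B `<=` H -> H `<=` W ->
    H = B \/ H = W) ->
  Lam `<=` Sig ->
  (forall a b w, Lam a -> Lam b -> W w -> B (lie (lie a b) w)) ->
  (forall s l, Sig s -> Lam l -> Lam (lie s l)) ->
  A `<=` Lam -> conn G A ->
  (exists a w, [/\ A a, W w & ~ B (lie a w)]) ->
  forall s l w, Sig s -> Lam l -> W w -> B (lie (lie s l) w).
Proof.
move=> cW cB BW SW SB minW LS Lcomm Lnorm AL cA [a0 [w0 [Aa0 Ww0 Nw0]]].
have sW := conn_subgroup cW; have sB := conn_subgroup cB; have sA := conn_subgroup cA.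
pose X := Subquotient sW sB BW.
pose Q := quot_system (X := X) (conn_dsub cW) (conn_dsub cB).
have stab s : Sig s -> stable X (ad s).
  by move=> Ss; split=> x Hx; [exact: SW|exact: SB].
have qad s : Sig s -> exists2 g, dend Q g & induces (X := X) (ad s) g.
  move=> Ss; exists (quot_endo (stab s Ss)); last exact: induces_quot_endo.
  exists (ad s); split; [exact: dend_ad|exact: stab|exact: induces_quot_endo].
pose ops (T : set r) : set (endo (quot X)) :=
  [set g | exists2 s, T s & induces (X := X) (ad s) g].
have ops_dend T g : T `<=` Sig -> ops T g -> dend Q g.
  move=> TS [s /TS Ss sg]; have [h dh sh] := qad s Ss.
  by rewrite (induces_inj sg sh).
have pi_comm s l (f g : endo (quot X)) w : Sig s -> Sig l -> W w -> induces (X := X) (ad s) f ->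
    induces (X := X) (ad l) g ->
    (f * g - g * f) (to_quot X w) = to_quot X (lie (lie s l) w).
  move=> Ss Sl Ww sf lg; rewrite endo_subE !endo_mulE (lg w) // (sf w) //.
  rewrite sf; last exact: (SW l).
  rewrite lg; last exact: (SW s).
  rewrite -to_quotB; [|exact/(SW s)/(SW l)|exact/(SW l)/(SW s)].
  by rewrite /= lie_leibniz addrK.
have comm_ops s l (f g : endo (quot X)) : Sig s -> Sig l -> induces (X := X) (ad s) f ->
    induces (X := X) (ad l) g ->
    GRing.comm f g <-> forall w, W w -> B (lie (lie s l) w).
  move=> Ss Sl sf lg; rewrite commutator0; split=> [E w Ww|H].
    have Wslw : W (lie (lie s l) w).
      have -> : lie (lie s l) w = lie s (lie l w) - lie l (lie s w).
        by rewrite lie_leibniz addrK.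
      by apply: subgroupB => //; [exact/(SW s)/(SW l)|exact/(SW l)/(SW s)].
    by apply/(to_quot_eq0 (X := X) Wslw); rewrite -(pi_comm s l f g) // E.
  apply: endoP => u; have [w Ww ->] := to_quot_surj u; rewrite (pi_comm s l) //.
  by apply/to_quot_eq0; [exact/BW/H|exact: H].
have ASig a : A a -> Sig a by move=> /AL /LS.
(* The pullback is the image of [A] under a definable map, plus [B]. This gives definability for the
   powers [p ^ n], and connectedness for [n = 1]. *)
have A_pullback (n : nat) w : W w ->
    pullback [set (g ^+ n) (to_quot X w) | g in ops A] =
    sum_set [set iter n (lie a) w | a in A] B.
  move=> Ww.
  have E a (g : endo (quot X)) : A a -> induces (X := X) (ad a) g ->
      W (iter n (lie a) w) /\ (g ^+ n) (to_quot X w) = to_quot X (iter n (lie a) w).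
    move=> Aa ag; elim: n => [|n [Wn En]] //.
    by rewrite exprS endo_mulE En ag //; split=> //; exact/SW/Wn/ASig.
  apply/seteqP; split.
    move=> x [Wx [g [a Aa ag]]]; have [Wa ->] := E _ _ Aa ag => Ex.
    exists (iter n (lie a) w); first by exists a.
    exists (x - iter n (lie a) w); last by rewrite addrC subrK.
    by apply/(to_quot_eq (X := X)).
  move=> _ [_ [a Aa <-] [b Bb <-]]; have [g dg ag] := qad a (ASig _ Aa).
  have [Wa Ea] := E _ _ Aa ag; split; first by apply: subgroupD => //; exact: (BW _).
  exists g; first by exists a.
  rewrite Ea to_quotD //; last exact: (BW _).
  by have -> := (to_quot_eq0 (X := X) (BW _ Bb)).2 Bb; rewrite addr0.
have comm_main := @commutation (quot X) d p Q p_pr d_lt_p (quot_exponent r_p)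
  (ops Sig) (ops Lam) (ops A).
move=> s l w Ss Ll Ww.
have [f df sf] := qad s Ss; have [g dg lg] := qad l (LS _ Ll).
apply: (comm_ops s l f g Ss (LS _ Ll) sf lg).1 => //.
apply: comm_main.
- by apply: conn_pullback; rewrite pullbackT.
- by move=> h; exact: ops_dend.
- move=> H dH invH.
  have dP : dsub G (pullback H) := dH.
  (* Minimality is assumed for connected subgroups only, so it is applied to the component of the
     pullback of [H], which differs from it by a finite index. *)
  have [C [cC CP fC maxC]] := component dP.
  have sH := quot_dsub_subgroup dH.
  have BC : B `<=` C by apply: maxC => //; exact: (sub_bot_pullback (X := X)).
  have CW : C `<=` W by move=> x /CP[].
  have iC : invariant Sig C.
    move=> t x St; apply: (component_invariant (dend_ad t) cC fC CP) => y [Wy Hy].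
    have [h dh th] := qad t St; split; first exact: SW.
    by rewrite -th //; apply: invH => //; exists t.
  case: (minW C cC iC BC CW) => E.
    right; apply: pullback_finite_index; rewrite pullback1.
    by rewrite -[sq_bot X]/B -E.
  left; apply/seteqP; split=> // u _; have [x Wx ->] := to_quot_surj u.
  by have /CP[] : C x by rewrite E.
- by move=> h; exact: ops_dend.
- move=> h h' [a La ah] [b Lb bh].
  by apply: (comm_ops a b h h' (LS _ La) (LS _ Lb) ah bh).2 => v; exact: Lcomm.
- move=> h h' [a Sa ah] [b Lb bh]; exists (lie a b); first exact: Lnorm.
  by move=> x Wx; rewrite (pi_comm a b) //; exact: LS.
- by move=> h [a Aa ah]; exists a => //; exact: AL.
- split; first by exists 0; [exact: subgroup0|move=> x Wx; rewrite /= lieC lie0r oppr0].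
  move=> h h' [a Aa ah] [b Ab bh]; exists (a - b); first exact: subgroupB.
  move=> x Wx; rewrite endo_subE ah // bh // /= lieBl to_quotB //; apply: SW => //; exact: ASig.
- have [h dh ah] := qad a0 (ASig _ Aa0); exists h; first by exists a0.
  move=> h0; apply: Nw0; apply/(to_quot_eq0 (X := X)); first by apply: SW => //; exact: ASig.
  by rewrite -[lie a0 w0]/(ad a0 w0) -ah // h0.
- move=> u; have [x Wx ->] := to_quot_surj u; apply: conn_pullback.
  have := A_pullback 1%N x Wx; rewrite /= => E.
  have -> : [set a (to_quot X x) | a in ops A] = [set (a ^+ 1) (to_quot X x) | a in ops A] by [].
  rewrite E; apply: conn_sum => //.
  exact: (conn_image (dend_rad x) cA).
- move=> n u sX; have [x Wx Ex] := to_quot_surj u.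
  split; last exact: subgroup_pullback.
  rewrite Ex A_pullback //; apply: definable_set_sum => //; last exact: (conn_dsub cB).1.
  apply: (definable_set_image m0); first exact: rdfun_iter_lie.
  exact: (conn_dsub cA).1.
- by exists s.
- by exists l.
Qed.

Lemma conn_lie_span I J : conn G J -> conn G (lie_span I J).
Proof.
move=> cJ; have sS := @subgroup_lie_span r I J.
have [|||A i [cA AS] Ii|U [cU US] FU] := @conn_sum_ind _ _ G _ I
    (fun x => ad x @` J) (fun U => conn G U /\ U `<=` lie_span I J).
- by split; [exact: conn0|move=> _ ->; exact: subgroup0].
- by move=> A [].
- by move=> x _; apply: subgroup_endo_image; exact: conn_subgroup cJ.
- split; first by apply: conn_sum => //; apply: conn_image => //; exact: dend_ad.
  by apply: sum_set_sub => // _ [y Jy <-]; exact: lie_spanP.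
suff -> : lie_span I J = U by [].
apply/seteqP; split=> //; apply: lie_span_sub; first exact: conn_subgroup cU.
by move=> x y Ix Jy; apply: (FU x Ix); exists y.
Qed.

(** * Connected ideals and minimal sections *)

Definition conn_ideal (I : set r) : Prop := conn G I /\ forall x y, I y -> I (lie x y).

Lemma conn_idealP I : conn_ideal I -> lie_ideal I.
Proof. by move=> [cI iI]; split=> //; exact: conn_subgroup cI. Qed.

Lemma conn_ideal_derived n : conn_ideal (derived_series [set: r] n).
Proof.
elim: n => [|n IH] //=; have cI := IH.1.
split; first exact: conn_lie_span.
by have [] := lie_ideal_span (conn_idealP IH) (conn_idealP IH).
Qed.

Lemma conn_ideal_component (K : set r) : dsub G K ->
  (forall x y, K y -> K (lie x y)) ->
  exists C, [/\ conn_ideal C, C `<=` K, finite_index C K &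
    forall A, conn G A -> A `<=` K -> A `<=` C].
Proof.
move=> dK iK; have [C [cC CK fC maxC]] := component dK.
exists C; split=> //; split=> // x; apply: (component_invariant (dend_ad x) cC fC CK).
exact: iK.
Qed.

(** The case [W = B] is allowed; properness is stated separately where it matters. *)
Definition minimal_pair (B W : set r) : Prop :=
  [/\ conn_ideal B, conn_ideal W, B `<=` W &
    forall H, conn_ideal H -> B `<=` H -> H `<=` W -> H = B \/ H = W].

(** As [a] acts centrally on [W / B], its kernel there is an ideal. The component of that kernel
    contains [W1], so by minimality it is [W]. *)
Lemma central_annihilator B W W1 a : minimal_pair B W ->
  (forall x w, W w -> B (lie (lie x a) w)) ->
  conn G W1 -> B `<=` W1 -> W1 `<=` W -> ~ (W1 `<=` B) ->
  (forall w, W1 w -> B (lie a w)) -> forall w, W w -> B (lie a w).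
Proof.
move=> [[cB iB] [cW iW] BW minW] ca cW1 BW1 W1W W1B aW1.
pose K := W `&` (ad a @^-1` B).
have dK : dsub G K.
  apply: dsubI; first exact: conn_dsub.
  by apply: dsub_preimage; [exact: dend_ad|exact: conn_dsub].
have [x y [Wy By]|C [iC CK fC maxC]] := conn_ideal_component dK.
  split; first exact: iW.
  rewrite /preimage /= lie_leibniz; apply: subgroupD; first exact: conn_subgroup cB.
    by rewrite (lieC a) lieNl; apply: subgroupN; [exact: conn_subgroup cB|exact: ca].
  exact: iB.
have BC : B `<=` C by apply: maxC => // x Bx; split; [exact: BW|exact: iB].
have W1C : W1 `<=` C by apply: maxC => // x Wx; split; [exact: W1W|exact: aW1].
have CW : C `<=` W by move=> x /CK[].
case: (minW C iC BC CW) => E; first by case: W1B; rewrite -E.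
by move=> w Ww; have /CK[] : C w by rewrite E.
Qed.

(* The last term [A] of the derived series acting nontrivially on [W / B] would
   be central there by a first use of [lie_commutation]; a second use, on a
   minimal section of [W / B] for two elements [x], [y] of the preceding term,
   shows that the central operator [lie x y] vanishes. *)
Theorem derived_annihilates B W x y w : minimal_pair B W -> W w ->
  B (lie (lie x y) w).
Proof.
move=> mp Ww; have [[cB iB] [cW iW] BW minW] := mp.
have sB := conn_subgroup cB; have sW := conn_subgroup cW.
pose ds := derived_series [set: r].
pose triv n := forall a v, ds n a -> W v -> B (lie a v).
have ex : exists n, `[< triv n >].
  have [n En] := r_soluble; exists n; apply/asboolP => a v.
  by rewrite /ds En => -> _; rewrite lieC lie0r oppr0; exact: subgroup0.
case: (ex_minnP ex) => m /asboolP trivm minm.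
(* [m] is the first term acting trivially; [m <= 1] is the claim. Otherwise [A], the term before it,
   acts nontrivially, and [C] is the term before [A]. *)
case: m trivm minm => [|[|k]] trivm minm; first exact: trivm.
  by apply: trivm => //; exact: lie_spanP.
exfalso; pose A := ds k.+1; pose C := ds k.
have [cA iA] : conn_ideal A := conn_ideal_derived k.+1.
have [cC iC] : conn_ideal C := conn_ideal_derived k.
have [a0 [w0 [Aa0 Ww0 N0]]] : exists a w, [/\ A a, W w & ~ B (lie a w)].
  apply: contrapT => N; have : (k.+2 <= k.+1)%N.
    apply: minm; apply/asboolP => a v Aa Wv; apply: contrapT => N2.
    by apply: N; exists a, v.
  by rewrite ltnn.
have A_central s a v : A a -> W v -> B (lie (lie s a) v).
  move=> Aa Wv.
  apply: (@lie_commutation W B [set: r] A A) => //.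
  - by move=> s' v' _; exact: iW.
  - by move=> s' v' _; exact: iB.
  - move=> H cH iH; apply: minW; split=> // s' v'; exact: iH.
  - by move=> a' b' v' Aa' Ab' Wv'; apply: trivm => //; exact: lie_spanP.
  - by move=> s' l' _; exact: iA.
  - by exists a0, w0.
have A_central' s a v : A a -> W v -> B (lie (lie a s) v).
  by move=> Aa Wv; rewrite (lieC a) lieNl; apply: subgroupN => //; exact: A_central.
(* [A] is spanned by brackets of elements of [C]; if these acted trivially, so would [a0]. *)
suff C_triv u v z : C u -> C v -> W z -> B (lie (lie u v) z).
  apply: N0; pose P := [set a | forall z, W z -> (rad z @^-1` B) a].
  suff : A `<=` P by move=> /(_ _ Aa0)/(_ _ Ww0).
  apply: lie_span_sub; last by move=> u v Cu Cv z; exact: C_triv.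
  split=> [z _|a b Pa Pb z Wz].
    by rewrite /preimage /= lie0l; exact: subgroup0.
  rewrite /preimage /= lieBl; apply: subgroupB => //; [exact: Pa|exact: Pb].
move=> Cu Cv.
have Auv : A (lie u v) by exact: lie_spanP.
have sA := conn_subgroup cA.
(* Brackets of [Sig] with [Lam] fall into [A], and [Lam] acts commutatively because [A] is central
   on [W / B]. *)
pose Sig s := A s \/ s = u \/ s = v.
pose Lam l := A l \/ l = v.
(* [W / B] is minimal for all of [r], not for the smaller [Sig], so a minimal [W1] is taken inside
   it. The next claim lifts annihilation by elements of [A] from [W1] back to [W]. *)
pose P H := [/\ conn G H, invariant Sig H, B `<=` H & ~ (H `<=` B)].
have [|W1 [_ [cW1 iW1 BW1 W1B] W1W minW1]] := @dsub_minimal _ _ G P W (conn_dsub cW).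
  split=> //; first by move=> s' v' _; exact: iW.
  by move=> WB; apply: N0; apply: iB; exact: WB.
have annih a : A a -> (forall t, W1 t -> B (lie a t)) -> forall t, W t -> B (lie a t).
  by move=> Aa; apply: central_annihilator mp _ cW1 BW1 W1W W1B => x' t; exact: A_central.
move: z; apply: (annih) => // t W1t.
apply: (@lie_commutation W1 B Sig Lam A) => //.
- by move=> s' t' _; exact: iB.
- move=> H cH iH BH HW1.
  have [HB|HB] := pselect (H `<=` B); first by left; apply/seteqP.
  by right; apply: minW1 => //; exact: conn_dsub.
- by move=> l [Al|->]; [left|right; right].
- move=> a b t' La Lb W1t'; have Wt' := W1W _ W1t'.
  case: La Lb => [Aa _|->]; first exact: A_central'.
  by case=> [Ab|->]; [exact: A_central|rewrite liexx lie0l; exact: subgroup0].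
- move=> s' l' Ss [Al|->]; left; first exact: iA.
  case: Ss => [As|[->|->]] //; last by rewrite liexx; exact: (subgroup0 sA).
  by rewrite lieC; apply: (subgroupN sA); exact: iA.
- by move=> a Aa; left.
- apply: contrapT => N; apply: N0; apply: annih => // t' W1t'.
  by apply: contrapT => N2; apply: N; exists a0, t'.
- by right; left.
- by right.
Qed.

Lemma minimal_pair_above B : conn_ideal B -> B <> [set: r] ->
  exists W, minimal_pair B W /\ ~ (W `<=` B).
Proof.
move=> iB BT; pose P H := [/\ conn_ideal H, B `<=` H & ~ (H `<=` B)].
have [|W [_ [iW BW WB] _ minW]] := @dsub_minimal _ _ G P setT (dsubT G).
  by split=> // TB; apply: BT; apply/seteqP; split.
exists W; split=> //; split=> // H iH BH HW.
have [HB|HB] := pselect (H `<=` B); first by left; apply/seteqP.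
by right; apply: minW => //; exact: conn_dsub iH.1.
Qed.

(** Proper steps between connected ideals have infinite index, so the rank bound forces the chain to
    reach [r], where it then stays. *)
Lemma minimal_chain : exists (B : nat -> set r) (n : nat),
  [/\ B 0%N = [set 0], B n = [set: r], forall i, conn_ideal (B i) &
    forall i, minimal_pair (B i) (B i.+1) \/ B i = [set: r]].
Proof.
have iT : conn_ideal [set: r] by [].
have /choice[g Hg] : forall B, exists W, conn_ideal B -> conn_ideal W /\
    B `<=` W /\ (minimal_pair B W /\ ~ (W `<=` B) \/ B = setT).
  move=> B; have [iB|NB] := pselect (conn_ideal B); last by exists B => /NB.
  have [->|BT] := pselect (B = setT); first by exists setT => _; split=> //; split=> //; right.
  have [W [mp WB]] := minimal_pair_above iB BT.
  by exists W => _; case: (mp) => _ iW BW _; split=> //; split=> //; left.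
pose B i := iter i g [set 0].
have iB i : conn_ideal (B i).
  elim: i => [|i /Hg[]] //; split; first exact: conn0.
  by move=> x _ ->; rewrite lie0r.
have [|n nd fi] := @dsub_ascending _ _ G B (fun i _ => conn_dsub (iB i).1).
  by move=> i _; have [_ []] := Hg _ (iB i).
exists B, n; split=> //.
  have [_ [_ [[_ N]|//]]] := Hg _ (iB n).
  by case: N; apply: conn_sub fi; [exact: (iB n.+1).1|exact: conn_dsub (iB n).1].
by move=> i; have [_ [_ [[mp _]|E]]] := Hg _ (iB i); [left|right].
Qed.

(** Brackets act trivially on [W / B], so [ad a] commutes with [r] there and [H] is an ideal. If
    [H = W], then iterating [ad a] until it vanishes gives [W = B]. *)
Lemma minimal_pair_ad_nilpotent B W a : minimal_pair B W -> ad_nilpotent a ->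
  forall w, W w -> B (lie a w).
Proof.
move=> mp [n an]; have [[cB iB] [cW iW] BW minW] := mp.
have sB := conn_subgroup cB; have sW := conn_subgroup cW.
pose H := sum_set (ad a @` W) B.
have sH : additive_subgroup H by apply: subgroup_sum => //; exact: subgroup_endo_image.
have iH : conn_ideal H.
  split; first by apply: conn_sum => //; apply: conn_image => //; exact: dend_ad.
  move=> x _ [_ [w Ww <-] [b Bb <-]]; rewrite /= lieDr lie_leibniz -addrA addrC -addrA.
  exists (lie a (lie x w)); first by exists (lie x w) => //; exact: iW.
  exists (lie x b + lie (lie x a) w) => //.
  by apply: subgroupD => //; [exact: iB|exact: derived_annihilates mp Ww].
have BH : B `<=` H by apply: sum_setr; exact: subgroup_endo_image.
have HW : H `<=` W by apply: sum_set_sub => // _ [w Ww <-]; exact: iW.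
have aH w : W w -> H (lie a w).
  by move=> Ww; apply: sum_setl => //; exists w.
case: (minW H iH BH HW) => E w Ww; first by rewrite -E; exact: aH.
suff WB : W `<=` B by apply: WB; exact: iW.
have step m : W `<=` sum_set (iter m (lie a) @` W) B.
  elim: m => [|m IH] v Wv.
    by apply: sum_setl => //; exists v.
  have [_ [v' Wv' <-] [b Bb <-]] : H v by rewrite E.
  have [_ [t Wt <-] [b' Bb' <-]] := IH _ Wv'.
  exists (iter m.+1 (lie a) t); first by exists t.
  exists (lie a b' + b); first by apply: subgroupD => //; exact: iB.
  by rewrite /= lieDr addrA.
move=> v /(step n)[_ [t _ <-] [b Bb <-]].
by rewrite an add0r.
Qed.

Theorem connected_nilpotent_radical : exists F : set r,
  [/\ conn_ideal F, nilpotent F, nilpotent (lie_span [set: r] [set: r]),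
      lie_span [set: r] [set: r] `<=` F &
      forall u, conn G u -> (forall a, u a -> ad_nilpotent a) -> u `<=` F].
Proof.
have [B [n [B0 Bn iB mpB]]] := minimal_chain.
have sB i := conn_subgroup (iB i).1.
have key i x y w : B i.+1 w -> B i (lie (lie x y) w).
  by case: (mpB i) => [mp|-> //]; exact: derived_annihilates mp.
(* An intersection of preimages under [rad], hence definable by the descending chain condition. It
   contains every bracket, so it is an ideal. *)
pose N := [set a | forall iw : nat * r, B iw.1.+1 iw.2 -> (rad iw.2 @^-1` B iw.1) a].
have dN : dsub G N.
  apply: dsub_bigcap => -[i w] _; apply: dsub_preimage; first exact: dend_rad.
  exact: conn_dsub (iB i).1.
have sN := dsub_subgroup dN.
have spanN x y : N (lie x y) by move=> [i w] /= Bw; exact: key.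
have [x y Ny|F [iF FN fF maxF]] := conn_ideal_component dN; first exact: spanN.
have nilN A : additive_subgroup A -> A `<=` N -> nilpotent A.
  move=> sA AN.
  (* Each bracket with an element of [N] descends one step of the chain, from [B n = r] to
     [B 0 = 0]. *)
  have lcsB k : (k <= n)%N -> lower_central_series A k `<=` B (n - k)%N.
    elim: k => [|k IH] kn; first by rewrite subn0 Bn.
    apply: lie_span_sub => // x y Ax Ay.
    apply: (AN x Ax ((n - k.+1)%N, y)) => /=.
    by rewrite -subSn // subSS; exact: IH (ltnW kn) _ Ay.
  exists n; apply/seteqP; split; first by have := lcsB n (leqnn n); rewrite subnn B0.
  move=> _ ->; case: (n) => [|m]; first exact: subgroup0.
  exact: (subgroup0 (@subgroup_lie_span r _ _)).
have spanF : lie_span [set: r] [set: r] `<=` F.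
  apply: maxF; first exact: conn_lie_span.
  by apply: lie_span_sub => // x y _ _; exact: spanN.
exists F; split=> //.
- by apply: nilN => //; exact: conn_subgroup iF.1.
- apply: nilN; first exact: subgroup_lie_span.
  exact: subset_trans spanF FN.
- move=> u cu nu; apply: maxF => // a ua [i w] /= Bw.
  case: (mpB i) => [mp|-> //].
  exact: minimal_pair_ad_nilpotent mp (nu a ua) _ Bw.
Qed.

End LieSystem.

(** That [F] is largest is a case of the clause on ad-nilpotent elements, since a nilpotent ideal
    consists of such elements. *)
Theorem corollary1p2 (L : language) (M : structure L) (r : lieRingType)
    (D : lie_definable_in M r) (p rk : nat)
    (M_fmr : finite_morley_rank M)
    (r_connected : connected D [set: r])
    (r_soluble : soluble [set: r])
    (p_prime : prime p)
    (r_exponent : has_exponent r p)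
    (r_rank : morley_rank (range (chart D)) rk)
    (p_gt_rk : (rk < p)%N) :
  exists F : set r,
    [/\ largest_dcn_ideal D F,
        nilpotent (lie_span [set: r] [set: r]),
        lie_span [set: r] [set: r] `<=` F &
        forall u : set r, lie_subring u -> definable_set D u -> connected D u ->
          (forall a, u a -> ad_nilpotent a) -> u `<=` F].
Proof.
have [_ r_p p_min] := r_exponent.
(* Exponent [p > 1] makes [r] nonzero, so two chart values differ at some coordinate, and that
   coordinate provides an element of [M]. *)
have [m0] : exists m0 : M, True.
  have [x x0] : exists x : r, x <> 0.
    apply: contrapT => N; have := p_min 1%N isT; rewrite leqNgt prime_gt1 //.
    by case/(_ _)/notP => // x; apply: contrapT => x0; apply: N; exists x.
  have [i _] : exists i, chart D x i <> chart D 0 i.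
    apply: contrapT => N; apply: x0; apply: (chart_inj (l := D)); apply: funext => i.
    by apply: contrapT => Ni; apply: N; exists i.
  by exists (chart D x i).
move=> _.
have rank_bound : ~ rank_at_least D rk.+1 [set: r] := morley_rank_bound r_rank.
pose G := lie_system m0 rank_bound.
have r_conn : conn G [set: r].
  by apply/connP => //; exact: definable_setT.
have [F [[cF iF] nF nr rF uF]] :=
  connected_nilpotent_radical p_prime p_gt_rk r_p r_conn r_soluble.
have [dF sF] := conn_dsub cF.
exists F; split=> //; last first.
  by move=> u [su _] du cu; apply: uF; apply/connP.
split; first by split=> //; exact: (connP m0 rank_bound dF sF).2.
move=> I [iI dI cI [n In]]; apply: uF.
  by apply/connP => //; case: iI.
move=> a Ia; exists n.+1 => x.
by have := iter_lie_lower_central n iI Ia x; rewrite In.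
Qed.
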